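(* There exists a natural isomorphism $\mathcal{E}\mathrm{nds}(-)|_{\mathbf{lfGTree}^{\mathrm{Crs}}}\cong\pi_0^{\mathrm{Crs}}(-)|_{\mathbf{lfGTree}^{\mathrm{Crs}}}$ of functors $\mathbf{lfGTree}^{\mathrm{Crs}}\to\mathbf{Set}$, where $\mathbf{lfGTree}^{\mathrm{Crs}}$ is the category of locally finite geometric trees and coarse maps.
   Context: A geometric tree is a contractible simplicial $1$-complex equipped with the canonical path metric in which each edge is isometric to the unit interval; it is locally finite if each vertex has finitely many edges attached. Locally finite geometric trees are proper (closed bounded subsets are exactly the compact subsets) and (uniquely) geodesic: any $x,x'$ are joined by an isometric embedding $u_{x,x'}:[0,a_{x,x'}]\to T$ with $a_{x,x'}=d_T(x,x')$ from $x$ to $x'$. A map $f:X\to Y$ of metric spaces is controlled if for every $R>0$ there is $S>0$ such that $d_X(x,x')<R$ implies $d_Y(f(x),f(x'))<S$; (metrically) proper if preimages of bounded sets are bounded; coarse if both. Functor $\mathcal{E}\mathrm{nds}$ (on proper geodesic metric spaces and coarse maps): two metrically proper continuous maps $r,r':\mathbb{R}_{\ge0}\to X$ are equivalent if for every bounded $B\subseteq X$ there is $t\ge0$ such that $r([t,\infty))$ and $r'([t,\infty))$ lie in the same path component of $X\setminus B$. $\mathcal{E}\mathrm{nds}(X)$ is the set of classes $\mathrm{end}(r)$; every end is represented by a geodesic ray (an isometric embedding of $\mathbb{R}_{\ge0}$). For any map $r:\mathbb{R}_{\ge0}\to X$ to a geodesic space, $r^*(h)=u_{r(\lfloor h\rfloor),r(\lceil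 h\rceil)}\big(a_{r(\lfloor h\rfloor),r(\lceil h\rceil)}(h-\lfloor h\rfloor)\big)$ for some choice of geodesics. A coarse map $f:X\to Y$ is sent to $f_{\mathcal{E}}:\mathrm{end}(r)\mapsto\mathrm{end}((f\circ r)^* )$, $r$ a geodesic ray; this is a well-defined functor. Functor $\pi_0^{\mathrm{Crs}}$: for a coarse map $q:X\to\mathbb{R}_{\ge0}$, let $I_qX=\{(x,t)\in X\times\mathbb{R}_{\ge0}:t\le q(x)\}$ with the restriction of the max product metric. Coarse maps $f,g:X\to Y$ are coarse homotopic if there are coarse maps $q:X\to\mathbb{R}_{\ge0}$ and $H:I_qX\to Y$ with $H(x,0)=f(x)$, $H(x,q(x))=g(x)$; this is an equivalence relation. $\pi_0^{\mathrm{Crs}}(X)$ is the set of coarse homotopy classes $[\alpha]_0^{\mathrm{Crs}}$ of coarse maps $\alpha:\mathbb{R}_{\ge0}\to X$; a coarse map $f$ is sent to $f_*:[\alpha]_0^{\mathrm{Crs}}\mapsto[f\circ\alpha]_0^{\mathrm{Crs}}$. *)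

(* Defs.v *)
From HB Require Import structures.
From mathcomp Require Import all_boot all_order all_algebra.
From mathcomp Require Import all_classical all_reals all_analysis.

Set Implicit Arguments.
Unset Strict Implicit.
Unset Printing Implicit Defensive.

Import Order.TTheory GRing.Theory Num.Theory.
Import numFieldNormedType.Exports.

Local Open Scope classical_set_scope.
Local Open Scope ring_scope.

Section prod_metric.
Context {R : realType} (X Y : metricType R).

Definition prod_mdist (p q : X * Y) : R :=
  Num.max (mdist p.1 q.1) (mdist p.2 q.2).

Let prod_mdist_ge0 p q : 0 <= prod_mdist p q.
Proof. by rewrite le_max mdist_ge0. Qed.

Let prod_mdist_positivity p q : prod_mdist p q = 0 -> p = q.
Proof.
case: p q => [x y] [x' y'] d0; have /= := lexx (prod_mdist (x, y) (x', y')).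
rewrite {2}d0 ge_max => /andP[dx dy].
by congr (_, _); apply: mdist_positivity; apply/eqP; rewrite eq_le mdist_ge0 andbT.
Qed.

Let prod_ballEmdist p d : ball p d = [set q | prod_mdist p q < d].
Proof.
apply/seteqP; split => q; rewrite /ball/= /prod_ball ballEmdist /= ballEmdist /=.
  by move=> [? ?]; rewrite gt_max; apply/andP.
by rewrite gt_max => /andP.
Qed.

HB.instance Definition _ := PseudoMetric_isMetric.Build R (X * Y)%type
  prod_mdist_ge0 prod_mdist_positivity prod_ballEmdist.

End prod_metric.

Section set_type_metric.
Context {R : realType} {X : metricType R} (A : set X).

Definition set_mdist (x y : A) : R := mdist (set_val x) (set_val y).

Let set_mdist_ge0 x y : 0 <= set_mdist x y.
Proof. exact: mdist_ge0. Qed.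

Let set_mdist_positivity x y : set_mdist x y = 0 -> x = y.
Proof. by move=> /mdist_positivity; apply: val_inj. Qed.

Let set_ballEmdist x d : ball x d = [set y | set_mdist x y < d].
Proof.
by apply/seteqP; split => y; rewrite /ball/= /initial_ball ballEmdist.
Qed.

HB.instance Definition _ := PseudoMetric_isMetric.Build R (set_type A)
  set_mdist_ge0 set_mdist_positivity set_ballEmdist.

End set_type_metric.

(* The metric structure of the real line lives on the alias [R^o]. *)
Definition halfline (R : realType) : Type := [set x : R^o | 0 <= x].

HB.instance Definition _ (R : realType) := Metric.on (halfline R).

Section halfline.
Context {R : realType}.

Definition hval (h : halfline R) : R := set_val h.

Lemma hval_ge0 h : 0 <= hval h.
Proof. by case: h => x x0; exact: (set_mem x0). Qed.

Definition mkhalf (x : R) (x0 : 0 <= x) : halfline R :=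
  exist _ (x : R^o) (mem_set x0).

Lemma hfloor_subproof h : 0 <= (Num.floor (hval h))%:~R :> R.
Proof. by rewrite ler0z floor_ge0 hval_ge0. Qed.

Lemma hceil_subproof h : 0 <= (Num.ceil (hval h))%:~R :> R.
Proof. exact: le_trans (hval_ge0 h) (ceil_ge _). Qed.

Definition hfloor (h : halfline R) : halfline R := mkhalf (hfloor_subproof h).
Definition hceil (h : halfline R) : halfline R := mkhalf (hceil_subproof h).

End halfline.

Section coarse.
Context {R : realType}.
Implicit Types X Y Z : metricType R.

Definition metric_bounded X (B : set X) :=
  exists M : R, forall x y, B x -> B y -> mdist x y <= M.

Definition controlled X Y (f : X -> Y) :=
  forall r : R, 0 < r -> exists2 s : R, 0 < s &
    forall x x', mdist x x' < r -> mdist (f x) (f x') < s.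

Definition metrically_proper X Y (f : X -> Y) :=
  forall B, metric_bounded B -> metric_bounded (f @^-1` B).

Definition coarse X Y (f : X -> Y) := controlled f /\ metrically_proper f.

Record coarse_map X Y := CoarseMap {
  coarse_fun :> X -> Y;
  coarseP : coarse coarse_fun }.

Lemma coarse_id X : coarse (@id X).
Proof. by split=> // r r0; exists r. Qed.

Lemma coarse_comp X Y Z (g : Y -> Z) (f : X -> Y) :
  coarse g -> coarse f -> coarse (g \o f).
Proof.
move=> [cg pg] [cf pf]; split => [r r0|B bB]; last exact: (pf _ (pg _ bB)).
have [s s0 fs] := cf r r0; have [t t0 gt] := cg s s0.
by exists t => // x x' /fs /gt.
Qed.

Definition coarse_map_id X : coarse_map X X := CoarseMap (@coarse_id X).

Definition coarse_map_comp X Y Z (g : coarse_map Y Z) (f : coarse_map X Y) :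
  coarse_map X Z := CoarseMap (coarse_comp (coarseP g) (coarseP f)).

End coarse.

Section ends.
Context {R : realType}.
Implicit Types X Y : metricType R.

(* Paths are functions on the whole of [R] of which only the restriction to
   [0, 1] matters. *)
Definition path_component X (A : set X) (x : X) : set X :=
  [set y | exists g : R -> X, [/\ {within `[0, 1], continuous g},
     g 0 = x, g 1 = y & forall s, 0 <= s <= 1 -> A (g s)]].

Definition proper_ray X (r : halfline R -> X) :=
  continuous r /\ metrically_proper r.

Definition end_equiv X (r r' : halfline R -> X) :=
  forall B : set X, metric_bounded B ->
  exists t : halfline R, exists2 x, (~` B) x &
    forall h, hval t <= hval h ->
      path_component (~` B) x (r h) /\ path_component (~` B) x (r' h).

Definition end_of X (r : halfline R -> X) : set (halfline R -> X) :=
  [set r' | proper_ray r' /\ end_equiv r r'].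

Definition Ends X : set (set (halfline R -> X)) :=
  [set end_of r | r in @proper_ray X].

Definition geodesic_ray X (r : halfline R -> X) :=
  forall h h', mdist (r h) (r h') = mdist h h'.

(* As for paths, only the restriction of [u] to [0, d(x, x')] matters. *)
Definition geodesic X (x x' : X) (u : R -> X) :=
  [/\ u 0 = x, u (mdist x x') = x' &
      forall s t, 0 <= s <= mdist x x' -> 0 <= t <= mdist x x' ->
        mdist (u s) (u t) = `|s - t|].

Definition geodesic_choice X (u : X -> X -> R -> X) :=
  forall x x', geodesic x x' (u x x').

Definition star X (u : X -> X -> R -> X) (r : halfline R -> X) :
    halfline R -> X :=
  fun h => u (r (hfloor h)) (r (hceil h))
    (mdist (r (hfloor h)) (r (hceil h)) * (hval h - hval (hfloor h))).

(* [Ends_map f (end_of r)] is [end_of (star u (f \o r))] for any geodesic ray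
   [r] and any choice [u] of geodesics.  The union over all representatives is
   over one single class; it makes the definition independent of choices. *)
Definition Ends_map X Y (f : X -> Y) (e : set (halfline R -> X)) :
    set (halfline R -> Y) :=
  \bigcup_(r in [set r | geodesic_ray r /\ e r])
  \bigcup_(u in @geodesic_choice Y) end_of (star u (f \o r)).

End ends.

Arguments Ends {R} X.

Section pi0.
Context {R : realType}.
Implicit Types X Y : metricType R.

Definition cylinder X (q : X -> halfline R) : Type :=
  [set p : X * halfline R | hval p.2 <= hval (q p.1)].

HB.instance Definition _ X (q : X -> halfline R) := Metric.on (cylinder q).

Definition cyl_pt X (q : X -> halfline R) (p : cylinder q) : X :=
  (set_val p).1.
Definition cyl_time X (q : X -> halfline R) (p : cylinder q) : halfline R :=
  (set_val p).2.

Definition coarse_homotopic X Y (f g : X -> Y) :=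
  exists (q : X -> halfline R) (H : cylinder q -> Y),
    [/\ coarse q, coarse H,
        forall p, hval (cyl_time p) = 0 -> H p = f (cyl_pt p) &
        forall p, cyl_time p = q (cyl_pt p) -> H p = g (cyl_pt p)].

Definition crs_class X (a : halfline R -> X) : set (halfline R -> X) :=
  [set b | coarse b /\ coarse_homotopic a b].

Definition pi0Crs X : set (set (halfline R -> X)) :=
  [set crs_class a | a in @coarse R (halfline R) X].

(* Again a union over all representatives of a single class. *)
Definition pi0Crs_map X Y (f : X -> Y) (c : set (halfline R -> X)) :
    set (halfline R -> Y) :=
  \bigcup_(a in c) crs_class (f \o a).

End pi0.

Arguments pi0Crs {R} X.

(* A simplicial complex of dimension at most 1: its simplices are the
   singletons and the pairs of adjacent vertices. *)
Record complex1 := Complex1 {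
  vertex : eqType;
  adj : rel vertex;
  adj_sym : symmetric adj;
  adj_irr : irreflexive adj }.

Definition locally_finite (K : complex1) :=
  forall v : vertex K, finite_set [set w | adj v w].

Section realization.
Context {R : realType} (K : complex1).

(* Points are given by their barycentric coordinates. *)
Definition edge_pt (u v : vertex K) (s : R) : vertex K -> R :=
  fun w => (1 - s) * (w == u)%:R + s * (w == v)%:R.

Definition realization : set (vertex K -> R) :=
  [set x | exists u v s, [/\ (u == v) || adj u v, 0 <= s <= 1 &
                             x = edge_pt u v s]].

(* Polygonal paths: each step stays in a closed edge, which has length 1. *)
Inductive polygonal :
    (vertex K -> R) -> (vertex K -> R) -> R -> Prop :=
| polygonal_nil x : realization x -> polygonal x x 0
| polygonal_cons u v s t y l :
    adj u v -> 0 <= s <= 1 -> 0 <= t <= 1 ->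
    polygonal (edge_pt u v t) y l ->
    polygonal (edge_pt u v s) y (`|s - t| + l).

(* [+oo] when there is no path from [x] to [y]. *)
Definition path_dist (x y : vertex K -> R) : \bar R :=
  ereal_inf [set l%:E | l in polygonal x y].

End realization.

Arguments realization R K : clear implicits.

Definition contractible (R : realType) (T : topologicalType) :=
  exists (c : T) (H : T * R -> T),
    [/\ {within [set: T] `*` `[0, 1], continuous H},
        forall x, H (x, 0) = x & forall x, H (x, 1) = c].

(* The metric topology on the realization of a locally finite complex is its
   usual (weak) topology, so contractibility can be stated in [T]. *)
Definition is_lfGTree (R : realType) (T : metricType R) :=
  exists (K : complex1) (coord : T -> (vertex K -> R)),
    [/\ locally_finite K, set_bij [set: T] (realization R K) coord,
        forall x y, (mdist x y)%:E = path_dist (coord x) (coord y) &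
        contractible R T].

Record lfGTree (R : realType) := LfGTree {
  tree_space :> metricType R;
  lfGTreeP : is_lfGTree tree_space }.

Section functors.
Context {R : realType}.

(* The set [fun_ob X] is a subset of an ambient type [fun_sort X]; what [fun_map] does
   outside [fun_ob X] is irrelevant. *)
Record functor_data := FunctorData {
  fun_sort : lfGTree R -> Type;
  fun_ob : forall X, set (fun_sort X);
  fun_map : forall X Y : lfGTree R, coarse_map X Y -> fun_sort X -> fun_sort Y }.

Arguments fun_ob : clear implicits.
Arguments fun_map f {X Y} _ _.

Definition is_functor (F : functor_data) :=
  [/\ forall (X Y : lfGTree R) (f : coarse_map X Y),
        set_fun (fun_ob F X) (fun_ob F Y) (fun_map F f),
      forall (X : lfGTree R) x, fun_ob F X x ->
        fun_map F (coarse_map_id X) x = x &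
      forall (X Y Z : lfGTree R) (g : coarse_map Y Z) (f : coarse_map X Y) x,
        fun_ob F X x -> fun_map F (coarse_map_comp g f) x = fun_map F g (fun_map F f x)].

Definition naturally_isomorphic (F G : functor_data) :=
  exists eta : forall X, fun_sort F X -> fun_sort G X,
    (forall X, set_bij (fun_ob F X) (fun_ob G X) (eta X)) /\
    (forall (X Y : lfGTree R) (f : coarse_map X Y) x, fun_ob F X x ->
       eta Y (fun_map F f x) = fun_map G f (eta X x)).

End functors.

Arguments fun_ob {R} f X _.
Arguments fun_map {R} f {X Y} _ _.

Definition EndsF (R : realType) : @functor_data R :=
  @FunctorData R (fun X => set (halfline R -> X)) (fun X => Ends X)
    (fun X Y (f : coarse_map X Y) => Ends_map f).

Definition pi0CrsF (R : realType) : @functor_data R :=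
  @FunctorData R (fun X => set (halfline R -> X)) (fun X => pi0Crs X)
    (fun X Y (f : coarse_map X Y) => pi0Crs_map f).

(* Main.v *)
(** A real tree is a geodesic metric space satisfying the four-point
    inequality; equivalently, its Gromov product (x|y) at a base point is
    ultrametric.  In a real tree two proper rays define the same end, and two
    coarse maps from the half-line are coarsely homotopic, under the very same
    condition: (a(h)|b(h')) tends to infinity with h and h'.  For ends, a path
    staying at distance at least n from the base point has endpoints with
    product at least n (up to a constant), and conversely the geodesic from x
    to y stays at distance at least (x|y).  For coarse maps, the homotopy is the
    unit speed motion from a(h) to b(h) along geodesics; it is controlled by the
    four-point inequality, and proper because (a(h)|b(h)) tends to infinity.
    Geodesic rays represent all classes on both sides, and the natural
    isomorphism maps the end of a geodesic ray to its coarse homotopy class.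

    A locally finite geometric tree is a real tree.  Given a symmetric
    irreflexive relation E on the vertices, E(near x, near y), where near x is a
    vertex nearest to x, is a cocycle modulo 2 on pairs of close points of the
    realization; summing it along the trajectories of a contraction shows that
    it is a coboundary.  Taking for E the edges outside a spanning tree shows
    that there are none, and the distance can then be computed from depths and
    branching vertices, which yields the ultrametric Gromov product. *)
Require Import Defs.
From HB Require Import structures.
From mathcomp Require Import all_boot all_order all_algebra.
From mathcomp Require Import all_classical all_reals all_analysis.
From mathcomp Require Import lra.

Set Implicit Arguments.
Unset Strict Implicit.
Unset Printing Implicit Defensive.

Import Order.TTheory GRing.Theory Num.Theory.
Import numFieldNormedType.Exports.
Local Open Scope classical_set_scope.
Local Open Scope ring_scope.

(** * Continuity and paths *)

Section metric_topology.
Context {R : realType}.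

Lemma near_mdist (X : metricType R) (x : X) (P : X -> Prop) :
  (\near x, P x) <->
  exists2 e : R, 0 < e & forall y, mdist x y < e -> P y.
Proof.
split=> [/metricType_numDomainType.nbhs_mdistP[e /= e0 eP]|[e e0 eP]].
  by exists e.
by apply/metricType_numDomainType.nbhs_mdistP; exists e.
Qed.

Lemma continuous_mdist (X Y : metricType R) (f : X -> Y) :
  (forall x (e : R), 0 < e -> exists2 d : R, 0 < d &
     forall x', mdist x x' < d -> mdist (f x) (f x') < e) ->
  continuous f.
Proof.
move=> fc x; apply/metricType_numDomainType.cvgrPdist_lt => e e0.
exact/near_mdist/fc.
Qed.

Lemma continuous_mdistE (X Y : metricType R) (f : X -> Y) x (e : R) :
  continuous f -> 0 < e -> exists2 d : R, 0 < d &
     forall x', mdist x x' < d -> mdist (f x) (f x') < e.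
Proof.
move=> fc e0; apply/near_mdist.
exact: (metricType_numDomainType.cvgrPdist_lt _ _).1 (fc x) e e0.
Qed.

Lemma near_within_itv (s : R) (P : R -> Prop) :
  (\forall s' \near within `[0, 1] (nbhs s), P s') <->
  exists2 d : R, 0 < d &
    forall s', 0 <= s' <= 1 -> `|s - s'| < d -> P s'.
Proof.
rewrite near_withinE; split.
  move=> /nbhs_ballP[d /= d0 dP]; exists d => // s' s'01 ss'.
  by apply: dP => //=; rewrite in_itv.
move=> [d d0 dP]; apply/nbhs_ballP; exists d => //= s' ss'; rewrite in_itv/=.
by move=> s'01; apply: dP.
Qed.

Lemma path_continuousP (X : metricType R) (g : R -> X) :
  {within `[0, 1], continuous g} <->
  forall s, 0 <= s <= 1 -> forall e : R, 0 < e -> exists2 d : R, 0 < d &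
    forall s', 0 <= s' <= 1 -> `|s - s'| < d -> mdist (g s) (g s') < e.
Proof.
split.
  move=> /subspace_continuousP gc s s01 e e0; apply/near_within_itv.
  have s01' : [set` `[0, 1]] s by rewrite /= in_itv.
  exact: (metricType_numDomainType.cvgrPdist_lt _ _).1 (gc s s01') e e0.
move=> gc; apply/subspace_continuousP => s; rewrite /= in_itv /= => s01.
apply/metricType_numDomainType.cvgrPdist_lt => e e0.
exact/near_within_itv/gc.
Qed.

(** Connectedness of the unit interval: [P] persists at the supremum of the initial segments on
    which it holds and, if that supremum is less than 1, also slightly beyond it. *)
Lemma unit_interval_ind (P : R -> Prop) :
  (forall s, 0 <= s <= 1 -> exists2 d : R, 0 < d &
    forall s', 0 <= s' <= 1 -> `|s - s'| < d -> (P s <-> P s')) ->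
  P 0 -> P 1.
Proof.
move=> Ploc P0.
pose S := [set s : R | 0 <= s <= 1 /\ forall t, 0 <= t <= s -> P t].
have S0 : S 0.
  split; first by rewrite lexx ler01.
  by move=> t t0; have -> : t = 0 by apply/eqP; rewrite eq_le andbC.
have supS : has_sup S.
  by split; [exists 0|exists 1 => s [/andP[]]].
have s01 : 0 <= sup S <= 1.
  by rewrite ub_le_sup//=; [apply: ge_sup; [exists 0|move=> s [/andP[]]]|case: supS].
have [d d0 Pd] := Ploc _ s01.
have [s Ss sS] := sup_adherent d0 supS.
have [/andP[s0 s1] Ps] := Ss.
have ssup : s <= sup S by apply: ub_le_sup => //; case: supS.
have Psup : P (sup S).
  apply/(Pd s); first by rewrite s0.
    by rewrite ger0_norm ?subr_ge0//; lra.
  by apply: Ps; rewrite s0 lexx.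
have PS t : 0 <= t <= 1 -> t < sup S + d -> P t.
  move=> t01 td; have [ts|st] := leP t s.
    by apply: Ps; move: t01 => /andP[-> _].
  apply/(Pd t) => //; rewrite ltr_norml; apply/andP; split; lra.
have [s1'|s1'] := ltP (sup S) 1; last first.
  by apply: PS; [rewrite ler01 lexx|lra].
pose s' := Num.min 1 (sup S + d / 2).
have : S s'.
  split; first by rewrite le_min ge_min; lra.
  move=> t /andP[t0]; rewrite le_min => /andP[t1 tS].
  by apply: PS; [rewrite t0|lra].
move=> /(ub_le_sup (proj2 supS)); rewrite ge_min => /orP[|]; lra.
Qed.

End metric_topology.

(** * Gromov products and asymptotic maps *)

Section halfline_metric.
Context {R : realType}.
Implicit Types h : halfline R.

Lemma mdist_halfline h h' : mdist h h' = `|hval h - hval h'|.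
Proof. exact: distrC. Qed.

Lemma hval_inj : injective (@hval R).
Proof. exact: val_inj. Qed.

Definition habs (x : R) : halfline R := mkhalf (normr_ge0 x).

Lemma hval_habs x : hval (habs x) = `|x|. Proof. by []. Qed.

Lemma habsK h : habs (hval h) = h.
Proof. by apply: hval_inj; rewrite hval_habs ger0_norm// hval_ge0. Qed.

Lemma mdist_habs x y : mdist (habs x) (habs y) <= `|x - y|.
Proof. by rewrite mdist_halfline !hval_habs ler_dist_dist. Qed.

End halfline_metric.

Section boundedness.
Context {R : realType} {X : metricType R} (o : X).

Lemma metric_boundedP (B : set X) :
  metric_bounded B <-> exists M : R, forall x, B x -> mdist o x <= M.
Proof.
split=> [[M BM]|[M BM]]; last first.
  exists (M + M) => x y /BM xM /BM yM; apply: le_trans (metric_triangle x o y) _.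
  by rewrite (metric_sym x) lerD.
have [[x Bx]|B0] := pselect (exists x, B x); last first.
  by exists 0 => x Bx; case: B0; exists x.
exists (mdist o x + M) => y By; apply: le_trans (metric_triangle o x y) _.
by rewrite lerD2l BM.
Qed.

Lemma metric_bounded_cball (M : R) : metric_bounded [set x | mdist o x <= M].
Proof. by apply/metric_boundedP; exists M. Qed.

End boundedness.

Lemma halfline_boundedP {R : realType} (B : set (halfline R)) :
  metric_bounded B <-> exists M : R, forall h, B h -> hval h <= M.
Proof.
have hE (h : halfline R) : mdist (habs 0) h = hval h.
  by rewrite mdist_halfline hval_habs normr0 sub0r normrN ger0_norm// hval_ge0.
split=> [/(metric_boundedP (habs 0))|] [M BM].
  by exists M => h /BM; rewrite hE.
by apply/(metric_boundedP (habs 0)); exists M => h /BM; rewrite hE.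
Qed.

Lemma ray_properP {R : realType} {X : metricType R} (o : X)
    (a : halfline R -> X) :
  metrically_proper a <->
  forall M : R, exists t : R, forall h, t <= hval h -> M < mdist o (a h).
Proof.
split=> [pa M|pa B /(metric_boundedP o)[M BM]].
  have /halfline_boundedP[t tP] := pa _ (metric_bounded_cball o M).
  exists (t + 1) => h th; rewrite ltNge; apply/negP => /tP; lra.
have [t tP] := pa M; apply/halfline_boundedP; exists t => h /BM haM.
by rewrite leNgt; apply/negP => /ltW/tP; rewrite ltNge haM.
Qed.

Lemma geodesic_distl {R : realType} {X : metricType R} (x y : X) u s :
  geodesic x y u -> 0 <= s <= mdist x y -> mdist x (u s) = s.
Proof.
move=> [u0 _ uP] s01.
by rewrite -{1}u0 uP ?lexx ?mdist_ge0// sub0r normrN ger0_norm; lra.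
Qed.

Lemma geodesic_distr {R : realType} {X : metricType R} (x y : X) u s :
  geodesic x y u -> 0 <= s <= mdist x y -> mdist (u s) y = mdist x y - s.
Proof.
move=> [_ u1 uP] s01.
by rewrite -{1}u1 uP ?lexx ?mdist_ge0// ler0_norm; lra.
Qed.

Section gromov_product.
Context {R : realType} {X : metricType R} (o : X).
Implicit Types x y z : X.

Definition gromov x y : R := (mdist o x + mdist o y - mdist x y) / 2.

Lemma gromovC x y : gromov x y = gromov y x.
Proof. by rewrite /gromov (metric_sym x y); lra. Qed.

Lemma gromovxx x : gromov x x = mdist o x.
Proof. by rewrite /gromov mdistxx; lra. Qed.

Lemma gromov_lel x y : gromov x y <= mdist o x.
Proof. by have := metric_triangle o x y; rewrite /gromov; lra. Qed.

(** Add the triangle inequalities from [o] through [u s] to [x] and to [y]; the two legs leaving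
    [u s] sum to [mdist x y]. *)
Lemma gromov_le_geodesic x y u s : geodesic x y u -> 0 <= s <= mdist x y ->
  gromov x y <= mdist o (u s).
Proof.
move=> xy s01; have dx := geodesic_distl xy s01; have dy := geodesic_distr xy s01.
have := metric_triangle o (u s) x; have := metric_triangle o (u s) y.
by rewrite (metric_sym (u s) x) dx dy /gromov; lra.
Qed.

End gromov_product.

(** Gromov's 0-hyperbolicity: among the three ways of pairing four points, the two largest sums of
    distances agree. *)
Definition four_point {R : realType} (X : metricType R) :=
  forall x y z w : X, mdist x y + mdist z w <=
    Num.max (mdist x z + mdist y w) (mdist x w + mdist y z).

Definition real_tree {R : realType} (X : metricType R) :=
  (forall x y : X, exists u, geodesic x y u) /\ four_point X.

Section four_point_geometry.
Context {R : realType} {X : metricType R} (X4 : four_point X) (o : X).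
Implicit Types x y z : X.
Local Notation gromov := (gromov o).

(** This is the four-point inequality for [x], [z], [o], [y]. In threshold form it can be iterated
    along chains without any loss. *)
Lemma gromov_ultra (M : R) y x z :
  M <= gromov x y -> M <= gromov y z -> M <= gromov x z.
Proof.
have := X4 x z o y; rewrite /gromov le_max.
rewrite (metric_sym x o) (metric_sym z o) (metric_sym z y).
by move=> /orP[]; lra.
Qed.

(** The points [u s] and [v s] have product [s] with [x] and [y] respectively, so their mutual
    product is at least [s]. As both lie at distance [s] from [o], they coincide. *)
Lemma geodesic_agree x y u v s : geodesic o x u -> geodesic o y v ->
  0 <= s <= gromov x y -> u s = v s.
Proof.
move=> ou ov /andP[s0 sxy].
have sx : s <= mdist o x by exact: le_trans sxy (gromov_lel _ _ _).
have sy : s <= mdist o y.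
  by apply: le_trans sxy _; rewrite gromovC gromov_lel.
have dus : mdist o (u s) = s by apply: geodesic_distl ou _; rewrite s0.
have dvs : mdist o (v s) = s by apply: geodesic_distl ov _; rewrite s0.
have dux : mdist (u s) x = mdist o x - s by apply: geodesic_distr ou _; rewrite s0.
have dvy : mdist (v s) y = mdist o y - s by apply: geodesic_distr ov _; rewrite s0.
apply: mdist_positivity; apply/eqP; rewrite eq_le mdist_ge0 andbT.
have : s <= gromov (u s) (v s).
  apply: (gromov_ultra (y := x)); first by rewrite /gromov dus dux; lra.
  apply: (gromov_ultra sxy).
  by rewrite /gromov dvs (metric_sym y) dvy; lra.
by rewrite /gromov dus dvs; lra.
Qed.

(** Apply the four-point inequality to [u s], [u' s'], [x], [y]. In the worse alternative, [2 * r]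
    comes from comparing the lengths of the geodesics, [r] from [s - s'] and [r] from moving [y'] to
    [y]. *)
Lemma geodesic_fellow x y x' y' u u' s s' r :
  geodesic x y u -> geodesic x' y' u' ->
  0 <= s <= mdist x y -> 0 <= s' <= mdist x' y' ->
  mdist x x' <= r -> mdist y y' <= r -> `|s - s'| <= r ->
  mdist (u s) (u' s') <= 4 * r.
Proof.
move=> xu xu' sxy sxy' xx' yy'; rewrite ler_norml => ss'.
have := X4 (u s) (u' s') x y.
have := geodesic_distl xu sxy; have := geodesic_distr xu sxy.
have := geodesic_distl xu' sxy'; have := geodesic_distr xu' sxy'.
rewrite (metric_sym (u s) x) (metric_sym (u' s') x) => e1 e2 e3 e4.
have := metric_triangle (u' s') y' y; have := metric_triangle x x' (u' s').
have := metric_triangle x' x y'; have := metric_triangle x y y'.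
rewrite (metric_sym y' y) (metric_sym x' x) le_max => t1 t2 t3 t4.
by case/orP; lra.
Qed.

(** Consecutive points have product at least [M], since they are [S]-close and at distance at least
    [M + S] from [o]; ultrametricity carries this bound to any number of steps. *)
Lemma gromov_chain (M S : R) (x : nat -> X) : 0 <= S ->
  (forall n, M + S <= mdist o (x n)) ->
  (forall n, mdist (x n) (x n.+1) <= S) -> forall n, M <= gromov (x 0%N) (x n).
Proof.
move=> S0 xM xS; elim=> [|n IHn].
  by rewrite gromovxx; have := xM 0%N; lra.
apply: gromov_ultra IHn _; rewrite /gromov.
by have := xM n; have := xM n.+1; have := xS n; lra.
Qed.

(** Continuous counterpart of [gromov_chain]: points of the path at mutual distance less than 1 have
    product at least [M], so having product at least [M] with [g 0] is a locally constant
    condition. *)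
Lemma gromov_path (M : R) (g : R -> X) : {within `[0, 1], continuous g} ->
  (forall s, 0 <= s <= 1 -> M + 1 <= mdist o (g s)) -> M <= gromov (g 0) (g 1).
Proof.
move=> /path_continuousP gc gM.
apply: (unit_interval_ind (P := fun s => M <= gromov (g 0) (g s))); last first.
  by rewrite gromovxx; have := gM 0; rewrite lexx ler01 => /(_ isT); lra.
move=> s s01; have [d d0 dg] := gc s s01 1 ltr01.
exists d => // s' s01' ss'.
have ggM : M <= gromov (g s) (g s').
  by have := dg _ s01' ss'; have := gM _ s01; have := gM _ s01'; rewrite /gromov; lra.
split=> gs; first exact: gromov_ultra gs ggM.
by apply: gromov_ultra gs _; rewrite gromovC.
Qed.

(* [asymptotic a b]: the maps [a] and [b] tend to the same boundary point. *)
Definition asymptotic (a b : halfline R -> X) := forall M : R, exists t : R,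
  forall h h', t <= hval h -> t <= hval h' -> M <= gromov (a h) (b h').

Lemma asymptotic_sym a b : asymptotic a b -> asymptotic b a.
Proof.
move=> ab M; have [t tP] := ab M; exists t => h h' th th'.
by rewrite gromovC tP.
Qed.

Lemma asymptotic_trans b a c :
  asymptotic a b -> asymptotic b c -> asymptotic a c.
Proof.
move=> ab bc M; have [t tP] := ab M; have [t' tP'] := bc M.
exists (Num.max t t') => h h'; rewrite !ge_max => /andP[th th'] /andP[uh uh'].
exact: gromov_ultra (tP _ _ th uh) (tP' _ _ uh' uh').
Qed.

(** Moving the time from [h] to [h'] costs nothing by ultrametricity once [a] converges, so
    comparison at equal times suffices. *)
Lemma asymptotic_pointwise a b : asymptotic a a ->
  (forall M : R, exists t : R, forall h, t <= hval h -> M <= gromov (a h) (b h)) ->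
  asymptotic a b.
Proof.
move=> aa ab M; have [t tP] := aa M; have [t' tP'] := ab M.
exists (Num.max t t') => h h'; rewrite !ge_max => /andP[th th'] /andP[uh uh'].
exact: gromov_ultra (tP _ _ th uh) (tP' _ uh').
Qed.

Lemma asymptotic_close a b (S : R) : asymptotic a a ->
  (forall h, mdist (a h) (b h) <= S) -> asymptotic a b.
Proof.
move=> aa abS; apply: asymptotic_pointwise => // M.
have [t tP] := aa (M + S); exists t => h th.
have := tP _ _ th th; rewrite gromovxx.
have := metric_triangle o (b h) (a h); rewrite (metric_sym (b h)) /gromov.
have := abS h; have := mdist_ge0 (a h) (b h); lra.
Qed.

(** Sampled at unit steps, [a] is a chain of uniformly close points, which properness eventually
    keeps far from [o]; [gromov_chain] applies. *)
Lemma asymptotic_coarse a : coarse a -> asymptotic a a.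
Proof.
move=> [ca /(ray_properP o) pa] M.
(* The steps have length at most 1; control is stated for distances strictly below the radius, hence
   2. *)
have [S S0 aS] := ca 2 ltac:(lra).
have [t0 tP] := pa (M + S).
pose t := `|t0|; exists t => h h' th th'.
have key k : t <= hval k -> M <= gromov (a (habs t)) (a k).
  (* Truncation at [hval k] makes the walk end exactly at [a k]. *)
  move=> tk; pose x n := a (habs (Num.min (t + n%:R) (hval k))).
  have t00 : 0 <= t by exact: normr_ge0.
  have k0 := hval_ge0 k.
  have mE n : `|Num.min (t + n%:R) (hval k)| = Num.min (t + n%:R) (hval k).
    by rewrite ger0_norm// le_min k0 addr_ge0.
  have := @gromov_chain M S x (ltW S0).
  have -> : x 0%N = a (habs t) by rewrite /x addr0 min_l.
  have [n kn] : exists n, x n = a k.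
    exists (Num.truncn (hval k)).+1; rewrite /x min_r ?habsK//.
    by have := truncnS_gt (hval k); lra.
  rewrite -kn; apply.
    move=> m; apply/ltW/tP; rewrite hval_habs mE le_min.
    have tt0 : t0 <= t by exact: ler_norm.
    by rewrite (le_trans tt0 tk) (le_trans tt0) ?lerDl.
  move=> m; apply/ltW/aS; rewrite mdist_halfline !hval_habs !mE.
  rewrite -natr1 addrA ltr_norml.
  by case: (leP (t + m%:R) (hval k)); case: (leP (t + m%:R + 1) (hval k)); lra.
by apply: (gromov_ultra (y := a (habs t))); rewrite ?key// gromovC key.
Qed.

(** A ray need not be controlled, so the chain is replaced by the affinely reparametrised piece of
    [r] between [h] and [h'], to which [gromov_path] applies. *)
Lemma asymptotic_proper_ray r : proper_ray r -> asymptotic r r.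
Proof.
move=> [rc /(ray_properP o) rp] M.
have [t tP] := rp (M + 1); exists t => h h' th th'.
pose g s := r (habs (hval h + s * (hval h' - hval h))).
have -> : r h = g 0 by rewrite /g mul0r addr0 habsK.
have -> : r h' = g 1 by rewrite /g mul1r addrC subrK habsK.
apply: gromov_path.
  apply/path_continuousP => s s01 e e0.
  have [d d0 dr] := continuous_mdistE (habs (hval h + s * (hval h' - hval h))) rc e0.
  (* The added 1 covers the degenerate case [h = h']. *)
  exists (d / (`|hval h' - hval h| + 1)).
    by rewrite divr_gt0// ltr_wpDl.
  move=> s' s01'; rewrite ltr_pdivlMr ?ltr_wpDl// => ss'.
  apply: dr; apply: le_lt_trans (mdist_habs _ _) _.
  rewrite opprD addrACA subrr add0r -mulrBl normrM; apply: le_lt_trans ss'.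
  by rewrite ler_wpM2l ?lerDl.
move=> s s01; apply/ltW/tP; rewrite hval_habs; apply: le_trans (ler_norm _).
rewrite -(subrK (hval h) t) addrC lerD2l.
have := hval_ge0 h; have := hval_ge0 h'.
nra.
Qed.

End four_point_geometry.

(** * Ends and coarse homotopies in real trees *)

Section cylinder_points.
Context {R : realType} {X : metricType R} (q : X -> halfline R).

Lemma mdist_cylinder (p p' : cylinder q) : mdist p p' =
  Num.max (mdist (cyl_pt p) (cyl_pt p')) (mdist (cyl_time p) (cyl_time p')).
Proof. by []. Qed.

Lemma cyl_time_le (p : cylinder q) : hval (cyl_time p) <= hval (q (cyl_pt p)).
Proof. by case: p => p pP; exact: (set_mem pP). Qed.

Lemma cyl_clip_subproof x (s : R) :
  [set p | hval p.2 <= hval (q p.1)] (x, habs (Num.min `|s| (hval (q x)))).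
Proof.
by rewrite /= hval_habs ger0_norm ?ge_min ?lexx ?orbT// le_min normr_ge0 hval_ge0.
Qed.

(** Clipping the time at [q x] lets a walk by unit steps up the fibre over [x] stop exactly at its
    top. *)
Definition cyl_clip x (s : R) : cylinder q :=
  exist _ (x, habs (Num.min `|s| (hval (q x)))) (mem_set (cyl_clip_subproof x s)).

Lemma cyl_time_clip x (s : R) :
  hval (cyl_time (cyl_clip x s)) = Num.min `|s| (hval (q x)).
Proof.
by rewrite /= hval_habs ger0_norm// le_min normr_ge0 hval_ge0.
Qed.

End cylinder_points.

Section real_tree_rays.
Context {R : realType} {X : metricType R} (Xtree : real_tree X) (o : X).
Implicit Types x y z : X.
Implicit Types a b r : halfline R -> X.
Local Notation gromov := (gromov o).
Local Notation asymptotic := (asymptotic o).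
Let X4 : four_point X := Xtree.2.

Lemma exists_geodesic_choice : exists u : X -> X -> R -> X, geodesic_choice u.
Proof.
have [u uP] := choice (fun p : X * X => Xtree.1 p.1 p.2).
by exists (fun x y => u (x, y)) => x y; exact: (uP (x, y)).
Qed.

Lemma geodesic_path x y u : geodesic x y u ->
  {within `[0, 1], continuous (fun s => u (s * mdist x y))}.
Proof.
move=> [_ _ uP]; apply/path_continuousP => s /andP[s0 s1] e e0.
exists (e / (mdist x y + 1)); first by rewrite divr_gt0// ltr_wpDl ?mdist_ge0.
have d0 := mdist_ge0 x y.
move=> s' /andP[s0' s1']; rewrite ltr_pdivlMr ?ltr_wpDl// => ss'.
rewrite uP ?mulr_ge0 ?ler_piMl// -mulrBl normrM (ger0_norm d0).
by apply: le_lt_trans ss'; rewrite ler_wpM2l// lerDl.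
Qed.

Lemma end_equivP r r' : proper_ray r -> proper_ray r' ->
  end_equiv r r' <-> asymptotic r r'.
Proof.
move=> pr pr'; split=> [rr' M|rr' B /(metric_boundedP o)[M BM]].
  (* The radius exceeds [M] by the slack 1 that [gromov_path] consumes. *)
  have [t [x xM xP]] := rr' _ (metric_bounded_cball o (M + 1)).
  exists (hval t) => h h' th th'.
  have key y : path_component (~` [set x | mdist o x <= M + 1]) x y ->
      M <= gromov x y.
    move=> [g [gc <- <- gM]]; apply: gromov_path => // s s01.
    by have /= := gM _ s01; case: leP => // + _; exact: ltW.
  apply: (gromov_ultra X4 (y := x)); last exact/key/(xP _ th').2.
  by rewrite gromovC; exact/key/(xP _ th).1.
have [t tP] := asymptotic_proper_ray X4 o pr (M + 1).
have [t' tP'] := rr' (M + 1).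
pose T := habs (`|t| + `|t'|).
have Th h : hval T <= hval h -> t <= hval h /\ t' <= hval h.
  rewrite hval_habs; move/(le_trans (ler_norm _)).
  have := ler_norm t; have := ler_norm t'.
  have := normr_ge0 t; have := normr_ge0 t'; lra.
(* The geodesic from [r T] to [y] stays at distance at least [M + 1] from [o], hence avoids [B]. *)
have key y : M + 1 <= gromov (r T) y -> path_component (~` B) (r T) y.
  move=> My; have [u uP] := Xtree.1 (r T) y.
  exists (fun s => u (s * mdist (r T) y)); split.
  - exact: geodesic_path.
  - by rewrite mul0r; case: uP.
  - by rewrite mul1r; case: uP.
  - move=> s /andP[s0 s1] /BM; apply/negP; rewrite -ltNge.
    apply: lt_le_trans (gromov_le_geodesic o uP (s := s * mdist (r T) y) _).
      by apply: lt_le_trans My; rewrite ltrDl.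
    by rewrite mulr_ge0 ?mdist_ge0 ?ler_piMl ?mdist_ge0.
have [tT tT'] := Th T (lexx _).
exists T, (r T).
  move=> /BM; apply/negP; rewrite -ltNge -gromovxx.
  by apply: lt_le_trans (tP _ _ tT tT); rewrite ltrDl.
move=> h /Th[th th']; split; apply: key; first exact: tP.
exact: tP'.
Qed.

(** Climbing the fibre over [h] by unit steps of time, [H] draws a chain from [a h] to [b h]; by
    properness of [H] the whole chain is far from [o] when [h] is large. *)
Lemma coarse_homotopic_asymptotic a b :
  coarse a -> coarse_homotopic a b -> asymptotic a b.
Proof.
move=> ca [q [H [cq [cH pH] H0 Hq]]].
apply: asymptotic_pointwise => //; first exact: asymptotic_coarse.
move=> M; have [S S0 HS] := cH 2 ltac:(lra).
have [t tP] : exists t : R, forall p : cylinder q, t <= hval (cyl_pt p) ->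
    M + S < mdist o (H p).
  (* Properness only bounds the diameter of the preimage of the ball. Unless it is empty, a
     threshold is obtained by measuring from one of its points. *)
  have [B BP] := pH _ (metric_bounded_cball o (M + S)).
  have [[p0 p0P]|nB] := pselect (exists p, mdist o (H p) <= M + S); last first.
    by exists 0 => p _; rewrite ltNge; apply/negP => pP; apply: nB; exists p.
  exists (hval (cyl_pt p0) + B + 1) => p pt; rewrite ltNge; apply/negP => pP.
  have := BP _ _ p0P pP; rewrite mdist_cylinder ge_max => /andP[+ _].
  by rewrite mdist_halfline ler_norml; lra.
exists t => h th.
pose x n := H (cyl_clip q h n%:R).
have qh0 := hval_ge0 (q h).
have <- : x 0%N = a h.
  by apply: H0; rewrite cyl_time_clip normr0 min_l.
have <- : x (Num.truncn (hval (q h))).+1 = b h.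
  apply: Hq; apply: hval_inj; rewrite cyl_time_clip ger0_norm// min_r//.
  exact/ltW/truncnS_gt.
apply: (gromov_chain X4 (S := S)) => [|n|n]; first exact: ltW.
  exact/ltW/tP.
apply/ltW/HS; rewrite mdist_cylinder gt_max mdistxx ltr0n /=.
rewrite mdist_halfline !cyl_time_clip !normr_nat -natr1 ltr_norml.
have := ler0n R n.
by case: (leP n%:R (hval (q h))); case: (leP (n%:R + 1) (hval (q h))); lra.
Qed.

Lemma asymptotic_coarse_homotopic a b :
  coarse a -> coarse b -> asymptotic a b -> coarse_homotopic a b.
Proof.
move=> [ca pa] [cb pb] ab.
have [u uP] := exists_geodesic_choice.
(* The distance alone need not be proper in [h]; adding [hval h] makes [q] proper, and the motion
   simply rests at [b h] during the extra time. *)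
have q0 h : 0 <= mdist (a h) (b h) + hval h by rewrite addr_ge0 ?mdist_ge0 ?hval_ge0.
pose q h := mkhalf (q0 h).
have qE h : hval (q h) = mdist (a h) (b h) + hval h by [].
pose m (p : cylinder q) :=
  Num.min (hval (cyl_time p)) (mdist (a (cyl_pt p)) (b (cyl_pt p))).
have mP p : 0 <= m p <= mdist (a (cyl_pt p)) (b (cyl_pt p)).
  by rewrite /m le_min hval_ge0 mdist_ge0/= ge_min lexx orbT.
have dab (S S' : R) x x' y y' : mdist x x' < S -> mdist y y' < S' ->
    mdist (x : X) y <= mdist x' y' + (S + S').
  move=> xx yy; have := metric_triangle x x' y; have := metric_triangle x' y' y.
  by rewrite (metric_sym y'); lra.
have dab' (S S' : R) x x' y y' : mdist x x' < S -> mdist y y' < S' ->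
    `|mdist (x : X) y - mdist x' y'| <= S + S'.
  move=> xx yy; have := dab S S' _ _ _ _ xx yy.
  rewrite (metric_sym x) (metric_sym y) in xx yy *.
  by have := dab S S' _ _ _ _ xx yy; rewrite ler_norml; lra.
have cq : controlled q.
  move=> r r0; have [S S0 aS] := ca r r0; have [S' S0' bS] := cb r r0.
  exists (S + S' + r); first lra.
  move=> h h' hh'; have := dab' _ _ _ _ _ _ (aS _ _ hh') (bS _ _ hh').
  move: hh'; rewrite !mdist_halfline !qE ltr_norml ler_norml ltr_norml; lra.
exists q, (fun p => u (a (cyl_pt p)) (b (cyl_pt p)) (m p)); split.
- split=> // B /halfline_boundedP[M BM]; apply/halfline_boundedP; exists M.
  by move=> h /BM; rewrite qE; have := mdist_ge0 (a h) (b h); lra.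
- split.
    move=> r r0; have [S S0 aS] := ca r r0; have [S' S0' bS] := cb r r0.
    exists (4 * (S + S' + r) + 1); first lra.
    move=> p p'; rewrite mdist_cylinder gt_max => /andP[pp' tt'].
    have aa' := aS _ _ pp'; have bb' := bS _ _ pp'.
    suff : mdist (u (a (cyl_pt p)) (b (cyl_pt p)) (m p))
       (u (a (cyl_pt p')) (b (cyl_pt p')) (m p')) <= 4 * (S + S' + r) by lra.
    apply: (geodesic_fellow X4 (uP _ _) (uP _ _)) => //; [lra|lra|].
    have := dab' _ _ _ _ _ _ aa' bb'; move: tt'.
    rewrite mdist_halfline ltr_norml !ler_norml /m.
    set d1 := mdist _ _; set d2 := mdist _ _.
    by case: (leP _ d1); case: (leP _ d2); lra.
  move=> B /(metric_boundedP o)[M BM].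
  (* For [h] beyond [t] the geodesic from [a h] to [b h] stays out of [B]. The base coordinate of
     the preimage is therefore bounded, and then so is its time, being at most [q]. *)
  have [t tP] := ab (M + 1).
  have [S S0 qS] := cq (`|t| + 1) ltac:(have := normr_ge0 t; lra).
  exists (Num.max `|t| (hval (q (habs 0)) + S)) => p p' Bp Bp'.
  have lep p1 : B (u (a (cyl_pt p1)) (b (cyl_pt p1)) (m p1)) ->
      hval (cyl_pt p1) <= `|t| /\ hval (cyl_time p1) <= hval (q (habs 0)) + S.
    move=> /BM oM; have tp : hval (cyl_pt p1) < t.
      rewrite ltNge; apply/negP => tp; have := tP _ _ tp tp.
      have := gromov_le_geodesic o (uP _ _) (mP p1); lra.
    have t1 := ler_norm t; have h0 := hval_ge0 (cyl_pt p1).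
    split; first lra.
    apply: le_trans (cyl_time_le p1) _.
    have := qS (cyl_pt p1) (habs 0); rewrite !mdist_halfline ltr_norml.
    rewrite ltr_norml hval_habs normr0; lra.
  have [tp sp] := lep p Bp; have [tp' sp'] := lep p' Bp'.
  have := hval_ge0 (cyl_pt p); have := hval_ge0 (cyl_pt p').
  have := hval_ge0 (cyl_time p); have := hval_ge0 (cyl_time p').
  move=> h1 h2 h3 h4.
  rewrite mdist_cylinder !mdist_halfline ge_max !le_max !ler_norml.
  by apply/andP; split; apply/orP; [left|right]; lra.
- move=> p p0; rewrite /m p0 min_l ?mdist_ge0//.
  by case: (uP (a (cyl_pt p)) (b (cyl_pt p))).
- move=> p pq; rewrite /m pq qE min_r ?lerDl ?hval_ge0//.
  by case: (uP (a (cyl_pt p)) (b (cyl_pt p))).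
Qed.

Lemma coarse_homotopicP a b : coarse a -> coarse b ->
  coarse_homotopic a b <-> asymptotic a b.
Proof.
move=> ca cb; split; first exact: coarse_homotopic_asymptotic.
exact: asymptotic_coarse_homotopic.
Qed.

End real_tree_rays.

(** * Piecewise geodesic maps and geodesic rays *)

Section star.
Context {R : realType} {X : metricType R} (u : X -> X -> R -> X).
Context (uP : geodesic_choice u).
Implicit Types a : halfline R -> X.

(** At an integer, floor and ceiling coincide and [star] evaluates a constant geodesic. The ends
    [s = 0] and [s = 1] are thus treated apart and shown to fit the formula of the open segment. *)
Lemma star_segment a (n : nat) (s : R) : 0 <= s <= 1 ->
  star u a (habs (n%:R + s)) =
  u (a (habs n%:R)) (a (habs n.+1%:R))
    (mdist (a (habs n%:R)) (a (habs n.+1%:R)) * s).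
Proof.
move=> /andP[s0 s1].
have floorE (z : int) (h : halfline R) : z%:~R <= hval h < (z + 1)%:~R ->
    hval (hfloor h) = z%:~R.
  by move=> zh; have <- := floor_def zh.
have ceilE (z : int) (h : halfline R) : (z - 1)%:~R < hval h <= z%:~R ->
    hval (hceil h) = z%:~R.
  by move=> zh; have <- := ceil_def zh.
have natE (m : nat) (h : halfline R) : hval h = m%:R -> h = habs m%:R.
  by move=> hm; apply: hval_inj; rewrite hval_habs normr_nat.
have hE : hval (habs (n%:R + s)) = n%:R + s by rewrite hval_habs ger0_norm ?addr_ge0.
have starE (m m' : nat) : hval (hfloor (habs (n%:R + s))) = m%:R ->
    hval (hceil (habs (n%:R + s))) = m'%:R ->
    star u a (habs (n%:R + s)) = u (a (habs m%:R)) (a (habs m'%:R))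
      (mdist (a (habs m%:R)) (a (habs m'%:R)) * (n%:R + s - m%:R)).
  by move=> fm cm; rewrite /star hE (natE _ _ fm) (natE _ _ cm) hval_habs normr_nat.
have [s1'|s1'] := ltP s 1; last first.
  have s1E : s = 1 by apply/eqP; rewrite eq_le s1 s1'.
  have {}hE : hval (habs (n%:R + s)) = n.+1%:R by rewrite hE -natr1; lra.
  rewrite (starE n.+1 n.+1).
  - rewrite mdistxx mul0r s1E mulr1; case: (uP (a (habs n.+1%:R)) (a (habs n.+1%:R))) => -> _ _.
    by case: (uP (a (habs n%:R)) (a (habs n.+1%:R))) => _ -> _.
  - by apply: (floorE n.+1); rewrite hE intrD -pmulrn; lra.
  - by apply: (ceilE n.+1); rewrite hE intrB -pmulrn; lra.
have flE : hval (hfloor (habs (n%:R + s))) = n%:R.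
  by apply: (floorE n); rewrite hE intrD -pmulrn; lra.
have [s00|s00] := eqVneq s 0.
  rewrite (starE n n)//.
    rewrite s00 mdistxx mul0r mulr0.
    case: (uP (a (habs n%:R)) (a (habs n%:R))) => -> _ _.
    by case: (uP (a (habs n%:R)) (a (habs n.+1%:R))) => -> _ _.
  by apply: (ceilE n); rewrite hE s00 addr0 intrB -pmulrn; lra.
rewrite (starE n n.+1)//; first by rewrite addrAC subrr add0r.
apply: (ceilE n.+1); rewrite hE intrB -pmulrn -natr1.
have : 0 < s by rewrite lt_neqAle eq_sym s00.
lra.
Qed.

Lemma halfline_segment (h : halfline R) : exists n : nat, exists2 s : R,
  0 <= s < 1 & h = habs (n%:R + s).
Proof.
have h0 := hval_ge0 h.
exists (Num.truncn (hval h)), (hval h - (Num.truncn (hval h))%:R).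
  have := truncn_itv h0; rewrite -natr1; lra.
by rewrite addrC subrK habsK.
Qed.

Lemma controlled_unit_step a : controlled a -> exists2 S : R, 0 < S &
  forall x y : R, `|x - y| <= 1 -> mdist (a (habs x)) (a (habs y)) <= S.
Proof.
move=> ca; have [S S0 aS] := ca 2 ltac:(lra); exists S => // x y xy.
by apply/ltW/aS; have := mdist_habs x y; lra.
Qed.

(** Both [a] and [star u a] stay within [S] of the value of [a] at the preceding integer, whence the
    bound [S + S]. *)
Lemma star_close a : controlled a -> exists S : R,
  forall h, mdist (a h) (star u a h) <= S.
Proof.
move=> /controlled_unit_step[S S0 aS]; exists (S + S) => h.
have [n [s /andP[s0 s1] ->]] := halfline_segment h.
have := metric_triangle (a (habs (n%:R + s))) (a (habs n%:R)) (star u a (habs (n%:R + s))).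
move=> /le_trans; apply; apply: lerD.
  by apply: aS; rewrite addrC addKr ger0_norm// ltW.
rewrite star_segment; last by rewrite s0 ltW.
have d0 := mdist_ge0 (a (habs n%:R)) (a (habs n.+1%:R)).
rewrite (geodesic_distl (uP _ _)); last by rewrite mulr_ge0//= ler_piMr// ltW.
have : mdist (a (habs n%:R)) (a (habs n.+1%:R)) <= S.
  by apply: aS; rewrite -natr1 opprD addNKr normrN1.
by move=> dS; apply: le_trans dS; rewrite ler_piMr// ltW.
Qed.

(** On each unit segment [star u a] is [S]-Lipschitz, and two times at distance at most 1 are
    separated by at most one segment boundary, so the Lipschitz bound extends to them. *)
Lemma continuous_star a : controlled a -> continuous (star u a).
Proof.
move=> /controlled_unit_step[S S0 aS].
pose g (x : R) := star u a (habs x).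
have seg (n : nat) s s' : 0 <= s <= 1 -> 0 <= s' <= 1 ->
    mdist (g (n%:R + s)) (g (n%:R + s')) <= S * `|s - s'|.
  move=> s01 s01'; rewrite /g !star_segment//.
  set d := mdist (a _) (a _).
  have d0 : 0 <= d by exact: mdist_ge0.
  move/andP: s01 => [s0 s1]; move/andP: s01' => [s0' s1'].
  case: (uP (a (habs n%:R)) (a (habs n.+1%:R))) => _ _ ->.
  - rewrite -mulrBr normrM (ger0_norm d0) ler_wpM2r// aS//.
    by rewrite -natr1 opprD addNKr normrN1.
  - by rewrite mulr_ge0//= ler_piMr.
  - by rewrite mulr_ge0//= ler_piMr.
have lip (x y : R) : 0 <= x -> x <= y <= x + 1 -> mdist (g x) (g y) <= S * `|x - y|.
  move=> x0 xy.
  have [n [s /andP[s0 s1] xE]] := halfline_segment (habs x).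
  have {}xE : x = n%:R + s.
    by have := congr1 (@hval R) xE; rewrite !hval_habs !ger0_norm// addr_ge0.
  have [yn|yn] := leP y (n%:R + 1).
    have -> : y = n%:R + (y - n%:R) by lra.
    rewrite xE; apply: le_trans (seg _ _ _ _ _) _; [lra|lra|].
    by have -> : n%:R + s - (n%:R + (y - n%:R)) = s - (y - n%:R) by lra.
  apply: le_trans (metric_triangle _ (g n.+1%:R) _) _.
  have -> : S * `|x - y| = S * `|s - 1| + S * `|0 - (y - n.+1%:R)|.
    by rewrite -mulrDr -natr1 !ler0_norm; [congr (_ * _); lra|lra|lra|lra].
  apply: lerD.
    by rewrite xE -natr1; apply: seg; lra.
  have := @seg n.+1 0 (y - n.+1%:R); rewrite addr0 (addrC _ (y - _)) subrK.
  by apply; rewrite -?natr1; lra.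
have lip' (x y : R) : 0 <= x -> 0 <= y -> `|x - y| <= 1 -> mdist (g x) (g y) <= S * `|x - y|.
  move=> x0 y0; have [xy|xy] := leP x y.
    by rewrite ler0_norm ?subr_le0// => xy1; rewrite -(@ler0_norm _ (x - y)) ?subr_le0// lip//; lra.
  rewrite distrC metric_sym => xy1; apply: lip => //.
  by move: xy1; rewrite ler_norml; lra.
apply: continuous_mdist => h e e0.
exists (Num.min 1 (e / S)); first by rewrite lt_min ltr01 divr_gt0.
move=> h'; rewrite lt_min mdist_halfline => /andP[h1].
rewrite ltr_pdivlMr// mulrC; apply: le_lt_trans.
rewrite -[h in mdist (star u a h)]habsK -[h' in mdist _ (star u a h')]habsK.
by apply: lip'; rewrite ?hval_ge0// ltW.
Qed.

Lemma proper_ray_star a : coarse a -> proper_ray (star u a).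
Proof.
move=> [ca pa]; split; first exact: continuous_star.
have [S aS] := star_close ca; move: pa.
move=> /(ray_properP (a (habs 0))) pa; apply/(ray_properP (a (habs 0))) => M.
have [t tP] := pa (M + S); exists t => h /tP.
have := metric_triangle (a (habs 0)) (star u a h) (a h).
by have := aS h; rewrite (metric_sym (star u a h)); lra.
Qed.

Lemma star_asymptotic o a : four_point X -> coarse a -> asymptotic o a (star u a).
Proof.
move=> X4 ca; have [S aS] := star_close ca.1.
by apply: (asymptotic_close X4 _ aS); exact: asymptotic_coarse.
Qed.

End star.

Section geodesic_rays.
Context {R : realType} {X : metricType R}.
Implicit Types r : halfline R -> X.

Lemma geodesic_ray_coarse r : geodesic_ray r -> coarse r.
Proof.
move=> gr; split.
  by move=> s s0; exists s => // h h'; rewrite gr.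
by move=> B [M BM]; exists M => h h' Bh Bh'; rewrite -gr; exact: BM.
Qed.

Lemma geodesic_ray_proper r : geodesic_ray r -> proper_ray r.
Proof.
move=> gr; split; last by case: (geodesic_ray_coarse gr).
by apply: continuous_mdist => h e e0; exists e => // h'; rewrite gr.
Qed.

(** The geodesics from [o] to points [x n] far along [r] agree up to time [n], by [geodesic_agree];
    their common initial parts glue to a ray. *)
Lemma exists_geodesic_ray o r : real_tree X -> proper_ray r ->
  exists2 g, geodesic_ray g & asymptotic o r g.
Proof.
move=> Xtree pr; have X4 := Xtree.2.
have [u uP] := exists_geodesic_choice Xtree.
have rr := asymptotic_proper_ray X4 o pr.
have [t tP] := choice (fun n : nat => rr n%:R).
pose x n := r (habs (t n)).
have t_le n : t n <= hval (habs (t n)) by exact: ler_norm.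
have xr n h : t n <= hval h -> n%:R <= gromov o (x n) (r h).
  by move=> th; apply: tP.
have xx m n (s : R) : s <= m%:R -> s <= n%:R -> s <= gromov o (x m) (x n).
  move=> sm sn; pose h := habs (`|t m| + `|t n|).
  have [hm hn] : t m <= hval h /\ t n <= hval h.
    rewrite hval_habs ger0_norm ?addr_ge0//.
    have := ler_norm (t m); have := ler_norm (t n).
    by have := normr_ge0 (t m); have := normr_ge0 (t n); lra.
  apply: (gromov_ultra X4 (y := r h)).
    exact: le_trans sm (xr _ _ hm).
  by rewrite gromovC; exact: le_trans sn (xr _ _ hn).
pose N (h : halfline R) := (Num.truncn (hval h)).+1.
have hN h : hval h <= (N h)%:R by exact/ltW/truncnS_gt.
have d_x n (s : R) : s <= n%:R -> s <= mdist o (x n).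
  by move=> sn; rewrite -gromovxx; exact: xx.
(* The index [N h] exceeds [hval h], so by [gE] any other index at least [hval h] gives the same
   point. *)
pose g h := u o (x (N h)) (hval h).
have gE h n : hval h <= n%:R -> g h = u o (x n) (hval h).
  move=> hn; apply: (geodesic_agree X4 (uP _ _) (uP _ _)).
  by rewrite hval_ge0; exact: xx.
have dg h n : hval h <= n%:R -> mdist (g h) (x n) = mdist o (x n) - hval h.
  move=> hn; rewrite (gE _ n)//; apply: geodesic_distr (uP _ _) _.
  by rewrite hval_ge0; exact: d_x.
have og h : mdist o (g h) = hval h.
  by apply: geodesic_distl (uP _ _) _; rewrite hval_ge0; exact/d_x.
exists g.
  move=> h h'; pose n := maxn (N h) (N h').
  have hn : hval h <= n%:R by apply: le_trans (hN h) _; rewrite ler_nat leq_maxl.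
  have hn' : hval h' <= n%:R by apply: le_trans (hN h') _; rewrite ler_nat leq_maxr.
  rewrite (gE h n)// (gE h' n)// mdist_halfline.
  case: (uP o (x n)) => _ _ ->//; rewrite hval_ge0 d_x//.
apply: asymptotic_pointwise => // M.
pose n := (Num.truncn `|M|).+1.
have Mn : M <= n%:R by apply: le_trans (ler_norm M) _; exact/ltW/truncnS_gt.
(* Ultrametricity is applied along [r h], [x n], [x m], [g h], where consecutive products are all at
   least [M]. *)
exists (Num.max (t n) n%:R) => h; rewrite ge_max => /andP[th nh].
have Mh : M <= hval h by exact: le_trans Mn nh.
pose m := N h.
have mn : n%:R <= m%:R :> R by exact: le_trans nh (hN h).
apply: (gromov_ultra X4 (y := x m)).
  apply: (gromov_ultra X4 (y := x n)); last by apply: xx => //; exact: le_trans Mn mn.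
  by rewrite gromovC; exact: le_trans Mn (xr _ _ th).
rewrite gromovC /gromov og (dg h m) ?hN//; lra.
Qed.

End geodesic_rays.

(** * The two functors on real trees *)

Section classes.
Context {R : realType} {X : metricType R} (Xtree : real_tree X) (o : X).
Implicit Types a b r : halfline R -> X.
Let X4 : four_point X := Xtree.2.

Lemma end_of_asymptotic r r' : proper_ray r -> end_of r r' -> asymptotic o r r'.
Proof. by move=> pr [pr' /(end_equivP Xtree o)]; exact. Qed.

Lemma end_of_eq r r' : proper_ray r -> proper_ray r' ->
  asymptotic o r r' -> end_of r = end_of r'.
Proof.
move=> pr pr' rr'; apply/seteqP; split=> s [ps].
  move=> /(end_equivP Xtree o pr ps) rs; split=> //.
  apply/(end_equivP Xtree o) => //.
  exact: (asymptotic_trans X4 (asymptotic_sym rr')).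
move=> /(end_equivP Xtree o pr' ps) rs; split=> //.
apply/(end_equivP Xtree o) => //.
exact: (asymptotic_trans X4 rr').
Qed.

Lemma crs_class_self a : coarse a -> crs_class a a.
Proof.
by move=> ca; split=> //; apply/(coarse_homotopicP Xtree o) => //; exact: asymptotic_coarse.
Qed.

Lemma crs_class_asymptotic a b : coarse a -> crs_class a b -> asymptotic o a b.
Proof. by move=> ca [cb /(coarse_homotopicP Xtree o)]; exact. Qed.

Lemma crs_class_eq a b : coarse a -> coarse b ->
  asymptotic o a b -> crs_class a = crs_class b.
Proof.
move=> ca cb ab; apply/seteqP; split=> c [cc].
  move=> /(coarse_homotopicP Xtree o ca cc) ac; split=> //.
  apply/(coarse_homotopicP Xtree o) => //.
  exact: (asymptotic_trans X4 (asymptotic_sym ab)).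
move=> /(coarse_homotopicP Xtree o cb cc) ac; split=> //.
apply/(coarse_homotopicP Xtree o) => //.
exact: (asymptotic_trans X4 ab).
Qed.

End classes.

Section functoriality.
Context {R : realType} {X Y : metricType R}.
Context (Xtree : real_tree X) (Ytree : real_tree Y) (o : X) (o' : Y).
Context (f : X -> Y) (cf : coarse f).
Implicit Types a b r : halfline R -> X.

(** No estimate on products is made: being asymptotic is being coarsely homotopic, and a coarse
    homotopy can be composed with [f]. *)
Lemma asymptotic_comp a b : coarse a -> coarse b ->
  asymptotic o a b -> asymptotic o' (f \o a) (f \o b).
Proof.
move=> ca cb /(coarse_homotopicP Xtree o ca cb) [q [H [cq cH H0 H1]]].
apply/(coarse_homotopicP Ytree); [exact: coarse_comp|exact: coarse_comp|].
exists q, (f \o H); split=> //; first exact: coarse_comp.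
  by move=> p /H0 /= ->.
by move=> p /H1 /= ->.
Qed.

(** Any two choices of a geodesic representative and of geodesics in [Y] yield asymptotic rays, so
    all members of the union are the same end. *)
Lemma Ends_map_end_of r g u : proper_ray r -> geodesic_ray g ->
  asymptotic o r g -> geodesic_choice u ->
  Ends_map f (end_of r) = end_of (star u (f \o g)).
Proof.
move=> pr gg rg uP.
have cfg g' : geodesic_ray g' -> coarse (f \o g').
  by move=> gg'; apply: coarse_comp => //; exact: geodesic_ray_coarse.
have eqE g' u' : geodesic_ray g' -> asymptotic o r g' -> geodesic_choice u' ->
    end_of (star u' (f \o g')) = end_of (star u (f \o g)).
  move=> gg' rg' uP'; have cg' := cfg _ gg'; have cg := cfg _ gg.
  apply: (end_of_eq Ytree (o := o')); [exact: proper_ray_star|exact: proper_ray_star|].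
  apply: (asymptotic_trans Ytree.2 (b := f \o g')).
    by apply/asymptotic_sym/star_asymptotic => //; case: Ytree.
  apply: (asymptotic_trans Ytree.2 (b := f \o g)).
    apply: asymptotic_comp; [exact: geodesic_ray_coarse|exact: geodesic_ray_coarse|].
    exact: (asymptotic_trans Xtree.2 (asymptotic_sym rg')).
  by apply: star_asymptotic => //; case: Ytree.
apply/seteqP; split=> [s [g' [gg' eg'] [u' uP'] es]|s es].
  rewrite -(eqE _ _ gg' _ uP')//.
  exact: (end_of_asymptotic Xtree).
exists g; last by exists u.
split=> //; split; first exact: geodesic_ray_proper.
by apply/(end_equivP Xtree o) => //; exact: geodesic_ray_proper.
Qed.

Lemma pi0Crs_map_crs_class a : coarse a ->
  pi0Crs_map f (crs_class a) = crs_class (f \o a).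
Proof.
move=> ca; apply/seteqP; split=> [c [b ab bc]|c ac].
  have cb : coarse b by case: ab.
  rewrite (crs_class_eq Ytree (o := o') (b := f \o b))//; try exact: coarse_comp.
  by apply: asymptotic_comp => //; exact: (crs_class_asymptotic Xtree).
by exists a => //; exact: (crs_class_self Xtree o).
Qed.

End functoriality.

(** On an end, all geodesic representatives have the same coarse class; the union avoids choosing
    one of them. *)
Definition end_to_crs {R : realType} (X : metricType R)
    (e : set (halfline R -> X)) : set (halfline R -> X) :=
  \bigcup_(g in [set g | geodesic_ray g /\ e g]) crs_class g.

Lemma end_to_crs_end_of {R : realType} {X : metricType R} (o : X)
    (r g : halfline R -> X) : real_tree X -> proper_ray r -> geodesic_ray g ->
  asymptotic o r g -> end_to_crs (end_of r) = crs_class g.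
Proof.
move=> Xtree pr gg rg; apply/seteqP; split=> [c [g' [gg' eg'] cg']|c gc].
  rewrite (crs_class_eq Xtree (o := o) (b := g'))//; try exact: geodesic_ray_coarse.
  apply: (asymptotic_trans Xtree.2 (asymptotic_sym rg)).
  exact: (end_of_asymptotic Xtree).
exists g => //; split=> //; split; first exact: geodesic_ray_proper.
by apply/(end_equivP Xtree o) => //; exact: geodesic_ray_proper.
Qed.

(** * Functoriality and the natural isomorphism, for trees known to be real trees *)

Section tree_functors.
Context {R : realType}.
Context (treeP : forall X : lfGTree R, real_tree X).
Implicit Types X Y Z : lfGTree R.

Lemma end_geodesic X (e : set (halfline R -> X)) : Ends X e ->
  exists (r g : halfline R -> X), [/\ proper_ray r, geodesic_ray g,
    e = end_of r & asymptotic (r (habs 0)) r g].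
Proof.
move=> [r pr <-]; have [g gg rg] := exists_geodesic_ray (r (habs 0)) (treeP X) pr.
by exists r, g.
Qed.

Lemma EndsF_map X Y (f : coarse_map X Y) (r : halfline R -> X)
    (u : Y -> Y -> R -> Y) : geodesic_ray r -> geodesic_choice u ->
  proper_ray (star u (f \o r)) /\
  fun_map (EndsF R) f (end_of r) = end_of (star u (f \o r)).
Proof.
move=> gr uP; have cf := coarseP f; have pr := geodesic_ray_proper gr.
split.
  by apply: proper_ray_star => //; apply: coarse_comp => //; exact: geodesic_ray_coarse.
pose o := r (habs 0).
apply: (Ends_map_end_of (treeP X) (treeP Y) (o := o) (f o)) => //.
exact: (asymptotic_proper_ray (treeP X).2).
Qed.

Lemma EndsF_functor : is_functor (EndsF R).
Proof.
split=> [X Y f e|X e|X Y Z g f e] /end_geodesic[r [s [pr gs -> rs]]].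
- have [u uP] := exists_geodesic_choice (treeP Y).
  have cf := coarseP f.
  rewrite /= (Ends_map_end_of (treeP X) (treeP Y) (f (r (habs 0))) cf pr gs rs uP).
  by exists (star u (f \o s)) => //; case: (EndsF_map f gs uP).
- have [u uP] := exists_geodesic_choice (treeP X).
  have cid : coarse (@id X) by exact: coarse_id.
  rewrite /= (Ends_map_end_of (treeP X) (treeP X) (r (habs 0)) cid pr gs rs uP).
  have cs := geodesic_ray_coarse gs.
  apply: (end_of_eq (treeP X)); [exact: proper_ray_star|exact: pr|].
  apply: (asymptotic_trans (treeP X).2 (b := s)); last exact: asymptotic_sym rs.
  by apply/asymptotic_sym/star_asymptotic => //; case: (treeP X).
- have [u uP] := exists_geodesic_choice (treeP Y).
  have [v vP] := exists_geodesic_choice (treeP Z).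
  have cf := coarseP f; have cg := coarseP g.
  pose o := f (r (habs 0)); pose o' := g o.
  have cgf := coarse_comp cg cf; have cs := geodesic_ray_coarse gs.
  have cfs := coarse_comp cf cs.
  have pt := proper_ray_star uP cfs.
  rewrite /= (Ends_map_end_of (treeP X) (treeP Y) o cf pr gs rs uP).
  rewrite (Ends_map_end_of (treeP X) (treeP Z) o' cgf pr gs rs vP).
  (* The map induced by [g] is evaluated on geodesic rays, and [star u (f \o s)] need not be one; it
     is replaced by an asymptotic geodesic ray. *)
  have [s' gs' ss'] := exists_geodesic_ray o (treeP Y) pt.
  rewrite (Ends_map_end_of (treeP Y) (treeP Z) o' cg pt gs' ss' vP).
  have cs' := geodesic_ray_coarse gs'.
  have cgfs := coarse_comp cgf cs; have cgs' := coarse_comp cg cs'.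
  apply: (end_of_eq (treeP Z) (o := o')); [exact: proper_ray_star|exact: proper_ray_star|].
  apply: (asymptotic_trans (treeP Z).2 (b := (g \o f) \o s)).
    by apply/asymptotic_sym/star_asymptotic => //; case: (treeP Z).
  apply: (asymptotic_trans (treeP Z).2 (b := g \o s')); last first.
    by apply: star_asymptotic => //; case: (treeP Z).
  apply: (asymptotic_comp (treeP Y) (treeP Z) (o := o) o' cg cfs cs').
  apply: (asymptotic_trans (treeP Y).2 _ ss').
  by apply: star_asymptotic => //; case: (treeP Y).
Qed.

Lemma pi0CrsF_map X Y (f : coarse_map X Y) (a : halfline R -> X) : coarse a ->
  fun_map (pi0CrsF R) f (crs_class a) = crs_class (f \o a).
Proof.
move=> ca; pose o := a (habs 0).
exact: (pi0Crs_map_crs_class (treeP X) (treeP Y) o (f o) (coarseP f)).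
Qed.

Lemma pi0CrsF_functor : is_functor (pi0CrsF R).
Proof.
split=> [X Y f c|X c|X Y Z g f c] [a ca <-].
- rewrite pi0CrsF_map//; exists (f \o a) => //.
  by apply: coarse_comp => //; exact: coarseP.
- by rewrite pi0CrsF_map.
- have cfa : coarse (f \o a) by apply: coarse_comp => //; exact: coarseP.
  by rewrite !pi0CrsF_map.
Qed.

Lemma EndsF_pi0CrsF_isomorphic : naturally_isomorphic (EndsF R) (pi0CrsF R).
Proof.
exists (fun X => @end_to_crs R X); split=> [X|X Y f e]; last first.
  move=> /end_geodesic[r [s [pr gs -> rs]]].
  have [u uP] := exists_geodesic_choice (treeP Y).
  have cf := coarseP f; pose o := f (r (habs 0)).
  have cs := geodesic_ray_coarse gs; have cfs := coarse_comp cf cs.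
  have pt := proper_ray_star uP cfs.
  rewrite (end_to_crs_end_of (treeP X) pr gs rs) pi0CrsF_map//=.
  rewrite (Ends_map_end_of (treeP X) (treeP Y) o cf pr gs rs uP).
  have [s' gs' ss'] := exists_geodesic_ray o (treeP Y) pt.
  rewrite (end_to_crs_end_of (treeP Y) pt gs' ss').
  apply: (crs_class_eq (treeP Y) (o := o)) => //; first exact: geodesic_ray_coarse.
  apply/asymptotic_sym/(asymptotic_trans (treeP Y).2 _ ss').
  by apply: star_asymptotic => //; case: (treeP Y).
split.
- move=> e /end_geodesic[r [s [pr gs -> rs]]].
  rewrite (end_to_crs_end_of (treeP X) pr gs rs).
  by exists s => //; exact: geodesic_ray_coarse.
- move=> e e' /set_mem/end_geodesic[r [s [pr gs -> rs]]].
  move=> /set_mem[r' pr' <-].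
  have [s' gs' rs'] := exists_geodesic_ray (r (habs 0)) (treeP X) pr'.
  rewrite (end_to_crs_end_of (treeP X) pr gs rs).
  rewrite (end_to_crs_end_of (treeP X) pr' gs' rs') => ss'.
  have cs := geodesic_ray_coarse gs; have cs' := geodesic_ray_coarse gs'.
  have : crs_class s s' by rewrite ss'; exact: (crs_class_self (treeP X) (r (habs 0))).
  move=> /(crs_class_asymptotic (treeP X) (r (habs 0)) cs) as'.
  apply: (end_of_eq (treeP X) (o := r (habs 0))) => //.
  apply: (asymptotic_trans (treeP X).2 rs).
  exact: (asymptotic_trans (treeP X).2 as' (asymptotic_sym rs')).
(* Surjectivity: a coarse map may be discontinuous, so it is first interpolated by [star] to define
   an end. *)
- move=> c [a ca <-].
  have [u uP] := exists_geodesic_choice (treeP X).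
  pose o := a (habs 0).
  have pt := proper_ray_star uP ca.
  have [s gs ts] := exists_geodesic_ray o (treeP X) pt.
  exists (end_of (star u a)); first by exists (star u a).
  rewrite (end_to_crs_end_of (treeP X) pt gs ts).
  apply: (crs_class_eq (treeP X) (o := o)) => //; first exact: geodesic_ray_coarse.
  apply/asymptotic_sym/(asymptotic_trans (treeP X).2 _ ts).
  by apply: star_asymptotic => //; case: (treeP X).
Qed.

End tree_functors.

(** * Coboundaries from contractibility *)

Section discrete_winding.
Context {R : realType} {T : metricType R} (c : T -> T -> bool) (eps : R).
Context (eps0 : 0 < eps).
Context (cocycle : forall x y z, mdist y x < eps -> mdist y z < eps ->
  c x y (+) c y z = c x z).

Lemma cocyclexx x : c x x = false.
Proof.
have : c x x (+) c x x = c x x by apply: cocycle; rewrite mdistxx.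
by rewrite addbb.
Qed.

(** Discrete line integral of [c] along [p], with values in Z/2. *)
Fixpoint variation (p : nat -> T) n :=
  if n is m.+1 then variation p m (+) c (p m) (p n) else false.

Lemma variation_cat p m n :
  variation p (m + n) = variation p m (+) variation (fun i => p (m + i)%N) n.
Proof.
by elim: n => [|n IHn]; rewrite ?addn0 ?addbF// addnS /= IHn addbA addnS.
Qed.

Lemma variation_small (p : nat -> T) n :
  (forall i j, (i <= n)%N -> (j <= n)%N -> mdist (p i) (p j) < eps) ->
  variation p n = c (p 0%N) (p n).
Proof.
elim: n => [|n IHn] pn; first by rewrite cocyclexx.
rewrite /= IHn; first by rewrite cocycle// pn.
by move=> i j iN jN; apply: pn; exact: leqW.
Qed.

(** Each block of [m] steps has diameter below [eps], so the cocycle relation collapses it to a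
    single step. *)
Lemma variation_refine (p : nat -> T) m n :
  (forall k i j, (k < n)%N -> (i <= m)%N -> (j <= m)%N ->
     mdist (p (k * m + i)%N) (p (k * m + j)%N) < eps) ->
  variation p (n * m) = variation (fun k => p (k * m)%N) n.
Proof.
elim: n => [|n IHn] pn //.
rewrite mulSnr variation_cat IHn /=; last first.
  by move=> k i j kn; apply: pn; exact: leqW.
congr addb; rewrite (variation_small (p := fun i => p (n * m + i)%N)).
  by rewrite addn0 mulSnr.
by move=> i j; exact: pn.
Qed.

(** A discrete Stokes formula on a strip of squares: cutting each square into two small triangles
    shows that [c] sums to zero around it. *)
Lemma variation_prism (p q : nat -> T) n :
  (forall k, (k < n)%N -> mdist (p k) (p k.+1) < eps) ->
  (forall k, (k < n)%N -> mdist (q k) (q k.+1) < eps) ->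
  (forall k, (k <= n)%N -> mdist (p k) (q k) < eps) ->
  variation p n (+) variation q n = c (p 0%N) (q 0%N) (+) c (p n) (q n).
Proof.
elim: n => [|n IHn] pn qn pqn; first by rewrite /= addbb.
have := IHn (fun k kn => pn k (leqW kn)) (fun k kn => qn k (leqW kn))
  (fun k kn => pqn k (leqW kn)).
have : c (p n) (q n) (+) c (q n) (q n.+1) = c (p n) (p n.+1) (+) c (p n.+1) (q n.+1).
  by rewrite !cocycle ?pqn ?pn ?qn// metric_sym ?pn ?pqn.
rewrite /=; move: (variation p n) (variation q n).
move: (c (p n) (q n)) (c (q n) (q n.+1)) (c (p n) (p n.+1)) (c (p n.+1) (q n.+1)) (c (p 0%N) (q 0%N)).
by do 7 case.
Qed.

End discrete_winding.

Section contractible_coboundary.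
Context {R : realType} {T : metricType R}.

Lemma homotopy_continuous (H : T * R -> T) :
  {within [set: T] `*` `[0, 1], continuous H} ->
  forall x t (e : R), 0 <= t <= 1 -> 0 < e -> exists2 d : R, 0 < d &
    forall y t', mdist x y < d -> 0 <= t' <= 1 -> `|t - t'| < d ->
      mdist (H (x, t)) (H (y, t')) < e.
Proof.
move=> /subspace_continuousP Hc x t e t01 e0.
have xt : ([set: T] `*` `[0, 1]) (x, t) by split; rewrite //= in_itv.
have := (metricType_numDomainType.cvgrPdist_lt _ _).1 (Hc _ xt) e e0.
rewrite near_withinE => -[[U V] /= [xU /nbhs_ballP[dV dV0 tV]] UV].
have [dU dU0 xU'] := (near_mdist _ _).1 xU.
exists (Num.min dU dV); first by rewrite lt_min dU0.
move=> y t'; rewrite !lt_min => /andP[yU _] t01' /andP[_ tV'].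
apply: (UV (y, t')); last by split; rewrite //= in_itv.
by split; [exact: xU'|exact: tV].
Qed.

(** Take for [A y] the sum of [c] along the trajectory of [y] under the contraction. The strip
    between the trajectories of nearby [x] and [y] contributes [c x y] at time 0 and [c b b], which
    vanishes, at time 1. *)
Lemma contractible_coboundary (c : T -> T -> bool) (eps : R) : 0 < eps ->
  (forall x y z, mdist y x < eps -> mdist y z < eps ->
     c x y (+) c y z = c x z) ->
  contractible R T ->
  exists A : T -> bool, forall x, exists2 d : R, 0 < d &
    forall y, mdist x y < d -> c x y = A x (+) A y.
Proof.
move=> eps0 cocycle [b [H [/homotopy_continuous Hc H0 H1]]].
pose fine y (n : nat) := forall s t, 0 <= s <= 1 -> 0 <= t <= 1 ->
  `|s - t| <= n.+1%:R^-1 -> mdist (H (y, s)) (H (y, t)) < eps.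
(* By compactness of the time interval, one mesh is fine enough for all trajectories starting near
   [x], and these stay close to that of [x]. *)
have unif x : exists n, exists2 d : R, 0 < d & forall y, mdist x y < d ->
    fine y n /\ forall t, 0 <= t <= 1 -> mdist (H (x, t)) (H (y, t)) < eps.
  have /compact_near_coveringP/near_covering_withinP cpt := @segment_compact R 0 1.
  pose P (i : R) (t : R) := forall y s, mdist x y < i -> 0 <= s <= 1 -> `|t - s| < i ->
    mdist (H (y, t)) (H (y, s)) < eps /\ mdist (H (x, t)) (H (y, t)) < eps.
  have : \forall i \near 0^'+, `[0, 1] `<=` P i.
    apply: cpt => t; rewrite /= in_itv /= => t01.
    (* Both distances to be bounded by [eps] are estimated through [H (x, t)], hence the halves. *)
    have [d d0 dH] := Hc x t (eps / 2) t01 ltac:(lra).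
    have d20 : 0 < d / 2 by lra.
    exists (ball t (d / 2), [set i | i < d / 2]).
      by split; [exact: nbhsx_ballx|exact: nbhs_right_lt].
    move=> [t' i] [/= tt' id]; rewrite in_itv /= => t01' y s xy s01 st.
    have tt : `|t - t'| < d by apply: lt_trans tt' _; lra.
    have ts : `|t - s| < d.
      by have := ler_distD t' t s; rewrite /ball /= in tt'; lra.
    have xy' : mdist x y < d by lra.
    have e1 := dH y t' xy' t01' tt; have e2 := dH y s xy' s01 ts.
    have e3 := dH x t' _ t01' tt; rewrite mdistxx in e3; have {}e3 := e3 d0.
    have := metric_triangle (H (y, t')) (H (x, t)) (H (y, s)).
    have := metric_triangle (H (x, t')) (H (x, t)) (H (y, t')).
    rewrite (metric_sym (H (y, t')) (H (x, t))) (metric_sym (H (x, t')) (H (x, t))).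
    by split; lra.
  move=> iP; have [i [i0 Pi]] : exists i, 0 < i /\ `[0, 1] `<=` P i.
    by apply: (@filter_ex _ (0^'+)); apply: filterI iP; exact: nbhs_right_gt.
  have K01 (t : R) : 0 <= t <= 1 -> [set` `[0, 1]] t by rewrite /= in_itv.
  exists (Num.truncn i^-1), i => // y xy; split=> [s t s01 t01 st|t t01].
    apply: (Pi _ (K01 _ s01) y t xy t01 _).1; apply: le_lt_trans st _.
    by rewrite invf_plt ?posrE// truncnS_gt.
  by apply: (Pi _ (K01 _ t01) y t xy t01 _).2; rewrite subrr normr0.
have [N NP] := choice unif.
have fineN y : fine y (N y).
  by have [d d0 dP] := NP y; apply: (dP y _).1; rewrite mdistxx.
pose p n (y : T) k := H (y, k%:R / n.+1%:R).
have p01 k n : (k <= n.+1)%N -> 0 <= k%:R / n.+1%:R <= (1 : R).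
  by move=> kn; rewrite divr_ge0//= ler_pdivrMr// mul1r ler_nat.
have step y n k : fine y n -> (k < n.+1)%N -> mdist (p n y k) (p n y k.+1) < eps.
  move=> fyn kn; apply: fyn; [exact/p01/ltnW|exact: p01|].
  by rewrite -mulrBl -natr1 opprD addNKr mulN1r normrN ger0_norm ?invr_ge0.
have halfindep y m n : fine y m ->
    variation c (fun k => H (y, k%:R / (m.+1 * n.+1)%:R)) (m.+1 * n.+1) =
    variation c (p m y) m.+1.
  move=> fym; rewrite (variation_refine eps0 cocycle).
    congr (variation c _ _); apply/funext => k; rewrite /p; congr (H (y, _)).
    by rewrite !natrM -mulf_div divff ?mulr1// pnatr_eq0.
  move=> k i j km im jm; apply: fym.
  - rewrite divr_ge0//= ler_pdivrMr ?ltr0n ?muln_gt0// mul1r ler_nat.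
    by apply: leq_trans (leq_mul km (leqnn n.+1)); rewrite mulSnr leq_add2l.
  - rewrite divr_ge0//= ler_pdivrMr ?ltr0n ?muln_gt0// mul1r ler_nat.
    by apply: leq_trans (leq_mul km (leqnn n.+1)); rewrite mulSnr leq_add2l.
  rewrite -mulrBl !natrD opprD addrACA subrr add0r normrM normfV normr_nat.
  rewrite natrM invfM mulrCA ler_piMr ?invr_ge0// ler_pdivrMr// mul1r.
  rewrite ler_norml -!(ler_nat R) in im jm *.
  by have := ler0n R i; have := ler0n R j; lra.
(* The mesh [N y] may jump with [y]; two fine meshes give the same sum through their common
   refinement, so [A y] can be computed with the mesh [N x]. *)
have indep y m n : fine y m -> fine y n ->
    variation c (p m y) m.+1 = variation c (p n y) n.+1.
  by move=> fym fyn; rewrite -(halfindep y m n)// mulnC -(halfindep y n m).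
exists (fun y => variation c (p (N y) y) (N y).+1) => x.
have [d d0 dP] := NP x; exists d => // y xy.
have [fyx xyt] := dP y xy.
rewrite (indep y (N y) (N x))// (variation_prism cocycle).
- by rewrite /p !mul0r !divff ?pnatr_eq0// !H0 !H1 (cocyclexx eps0 cocycle) addbF.
- by move=> k; apply: step; exact: fineN.
- by move=> k; exact: step.
- by move=> k kn; exact/xyt/p01.
Qed.

End contractible_coboundary.

(** * Coordinates on the realization *)

Section polygonal_paths.
Context {R : realType} {K : complex1}.
Implicit Types (u v w : vertex K) (s t l : R) (x y z : vertex K -> R).

Lemma edge_pt0 u v : edge_pt u v 0 = edge_pt u u (0 : R).
Proof. by apply/funext => w; rewrite /edge_pt !mul0r. Qed.

Lemma edge_pt1 u v : edge_pt u v 1 = edge_pt v v (0 : R).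
Proof. by apply/funext => w; rewrite /edge_pt subrr subr0 !mul0r mul1r add0r addr0. Qed.

Lemma edge_ptxx u s : edge_pt u u s = edge_pt u u (0 : R).
Proof. by apply/funext => w; rewrite /edge_pt; lra. Qed.

Lemma edge_pt_sym u v s : edge_pt u v s = edge_pt v u (1 - s).
Proof. by apply/funext => w; rewrite /edge_pt; lra. Qed.

Lemma edge_ptl u v s : u != v -> edge_pt u v s u = 1 - s.
Proof. by move=> /negbTE uv; rewrite /edge_pt eqxx uv mulr1 mulr0 addr0. Qed.

Lemma edge_ptr u v s : u != v -> edge_pt u v s v = s.
Proof. by rewrite eq_sym => /negbTE uv; rewrite /edge_pt eqxx uv mulr1 mulr0 add0r. Qed.

Lemma edge_pt_vertex u s : edge_pt u u s u = 1.
Proof. by rewrite /edge_pt eqxx !mulr1 subrK. Qed.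

Lemma edge_pt_gt0 u v s w : 0 < edge_pt u v s w -> w = u \/ w = v.
Proof.
rewrite /edge_pt; case: eqVneq => [->|_]; first by left.
by case: eqVneq => [->|_]; [right|rewrite !mulr0 addr0 ltxx].
Qed.

Lemma realization_vertex u : realization R K (edge_pt u u 0).
Proof. by exists u, u, 0; rewrite eqxx lexx ler01. Qed.

Lemma realization_edge u v s : adj u v -> 0 <= s <= 1 ->
  realization R K (edge_pt u v s).
Proof. by move=> uv s01; exists u, v, s; rewrite uv orbT. Qed.

Lemma polygonal_lipschitz x y l w : polygonal x y l -> `|x w - y w| <= l.
Proof.
elim=> [{}x _|u v s t {}y {}l uv s01 t01 _ IH]; first by rewrite subrr normr0.
apply: le_trans (ler_distD (edge_pt u v t w) _ _) _; apply: lerD => //.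
rewrite /edge_pt; have -> : (1 - s) * (w == u)%:R + s * (w == v)%:R -
  ((1 - t) * (w == u)%:R + t * (w == v)%:R) = (s - t) * ((w == v)%:R - (w == u)%:R) by lra.
rewrite normrM ler_piMr//.
by case: (w == v); case: (w == u); rewrite ?subrr ?normr0 ?subr0 ?normr1 ?sub0r ?normrN1 ?ler01.
Qed.

Lemma polygonal_edge u v s t : adj u v -> 0 <= s <= 1 -> 0 <= t <= 1 ->
  polygonal (edge_pt u v s) (edge_pt u v t) `|s - t|.
Proof.
move=> uv s01 t01; rewrite -[`|s - t|]addr0.
by apply: polygonal_cons => //; exact/polygonal_nil/realization_edge.
Qed.

Lemma polygonal_cat x y z l l' :
  polygonal x y l -> polygonal y z l' -> polygonal x z (l + l').
Proof.
elim=> [{}x _|u v s t {}y {}l uv s01 t01 _ IH] yz; first by rewrite add0r.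
by rewrite -addrA; apply: polygonal_cons => //; exact: IH.
Qed.

Lemma polygonal_sym x y l : polygonal x y l -> polygonal y x l.
Proof.
elim=> [{}x xK|u v s t {}y {}l uv s01 t01 _ IH]; first exact: polygonal_nil.
by rewrite addrC distrC; apply: polygonal_cat IH _; exact: polygonal_edge.
Qed.

End polygonal_paths.

Section tree_coordinates.
Context {R : realType} {T : metricType R} {K : complex1}.
Context (coord : T -> (vertex K -> R)).
Context (coord_bij : set_bij [set: T] (realization R K) coord).
Context (coord_dist : forall x y, (mdist x y)%:E = path_dist (coord x) (coord y)).
Implicit Types (x y z : T) (u v w : vertex K).

Lemma coord_realization x : realization R K (coord x).
Proof. by case: coord_bij => + _ _; apply. Qed.

Lemma coord_surj p : realization R K p -> exists x, coord x = p.
Proof. by case: coord_bij => _ _ sb /sb[x _ <-]; exists x. Qed.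

Lemma mdist_le_polygonal x y l : polygonal (coord x) (coord y) l -> mdist x y <= l.
Proof.
by move=> xy; rewrite -lee_fin coord_dist; apply: ereal_inf_lbound; exists l.
Qed.

Lemma mdist_ge_polygonal x y (m : R) :
  (forall l, polygonal (coord x) (coord y) l -> m <= l) -> m <= mdist x y.
Proof.
move=> ml; rewrite -lee_fin coord_dist; apply: le_ereal_inf_tmp => _ [l xy <-].
by rewrite lee_fin ml.
Qed.

(** The infimum of the empty set is infinite whereas [mdist] is finite: the metric itself forces
    connectedness. *)
Lemma polygonal_exists x y : exists l, polygonal (coord x) (coord y) l.
Proof.
apply: contrapT => nl; have := coord_dist x y; rewrite /path_dist.
have -> : [set l%:E | l in polygonal (coord x) (coord y)] = set0.
  by rewrite -subset0 => e [l xyl _]; apply: nl; exists l.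
by rewrite ereal_inf0.
Qed.

Lemma coord_lipschitz x y w : `|coord x w - coord y w| <= mdist x y.
Proof. by apply: mdist_ge_polygonal => l; exact: polygonal_lipschitz. Qed.

Lemma exists_nearest : exists near : T -> vertex K,
  forall x, 1 / 2 <= coord x (near x).
Proof.
suff : forall x, exists w, 1 / 2 <= coord x w by move=> /choice[near nearP]; exists near.
move=> x; have [u [v [s [uv s01 ->]]]] := coord_realization x.
have [<-|nuv] := eqVneq u v; first by exists u; rewrite edge_pt_vertex; lra.
have [s2|s2] := leP s (1 / 2).
  by exists u; rewrite edge_ptl//; lra.
by exists v; rewrite edge_ptr//; lra.
Qed.

(** A point has at most two nonzero coordinates, so among three such vertices two coincide. *)
Lemma coord_support x u v w :
  0 < coord x u -> 0 < coord x v -> 0 < coord x w -> [\/ u = v, v = w | u = w].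
Proof.
have [a [b [s [_ _ ->]]]] := coord_realization x.
move=> /edge_pt_gt0[]-> /edge_pt_gt0[]-> /edge_pt_gt0[]->;
  by [exact: Or31|exact: Or32|exact: Or33].
Qed.

(* Vanishing of the first cohomology of [K] with coefficients in [Z/2]. *)
Lemma contractible_cut (E : rel (vertex K)) : contractible R T ->
  symmetric E -> irreflexive E ->
  exists A : vertex K -> bool, forall u v, adj u v -> A u (+) A v = E u v.
Proof.
move=> Tcontr Esym Eirr; have [near nearP] := exists_nearest.
have E3 u v w : [\/ u = v, v = w | u = w] -> E u v (+) E v w = E u w.
  by case=> ->; rewrite ?Eirr ?addFb ?addbF// (Esym v) addbb.
have near_gt0 x y : mdist x y < 1 / 2 -> 0 < coord x (near y).
  by have := coord_lipschitz x y (near y); have := nearP y; rewrite ler_norml; lra.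
(* Coordinates are 1-Lipschitz, so the vertices nearest to [x], [y] and [z] all lie in the support
   of the middle point [y]; two of them coincide and [E3] gives the cocycle relation. *)
have [x y z yx yz|A AP] := @contractible_coboundary R T
    (fun x y => E (near x) (near y)) (1 / 2) ltac:(lra) _ Tcontr.
  apply: E3; apply: (@coord_support y); apply: near_gt0 => //.
  by rewrite mdistxx; lra.
have [pt ptP] := choice (fun u => coord_surj (realization_vertex u)).
exists (A \o pt) => u v uv.
have vert_near w x : coord x = edge_pt w w 0 -> near x = w.
  move=> xw; have := nearP x; rewrite xw => h.
  by have [] : near x = w \/ near x = w by apply: (@edge_pt_gt0 R K w w 0); lra.
have edge s : exists x, 0 <= s <= 1 -> coord x = edge_pt u v s.
  have [s01|] := boolP (0 <= s <= 1); last by exists (pt u).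
  by have [x] := coord_surj (realization_edge uv s01); exists x.
have [e eP] := choice edge.
(* Correcting [A] by the jump of the nearest vertex gives a locally constant function on the edge.
   Comparing its values at both ends yields the claim. *)
pose B s := A (e s) (+) E (near (e s)) u.
have near_e s : 0 <= s <= 1 -> near (e s) = u \/ near (e s) = v.
  move=> s01; apply: (@edge_pt_gt0 R K u v s); rewrite -eP//.
  by have := nearP (e s); lra.
have e0 : e 0 = pt u.
  case: coord_bij => _ inj _; apply: inj; rewrite ?in_setT//.
  by rewrite eP ?lexx ?ler01// edge_pt0 ptP.
have e1 : e 1 = pt v.
  case: coord_bij => _ inj _; apply: inj; rewrite ?in_setT//.
  by rewrite eP ?lexx ?ler01// edge_pt1 ptP.
have : B 0 = B 1.
  apply: (unit_interval_ind (P := fun s => B 0 = B s)) => // s s01.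
  have [d d0 dA] := AP (e s); exists d => // s' s01' ss'.
  suff -> : B s = B s' by [].
  have := dA (e s'); rewrite /B => H.
  have {}H : E (near (e s)) (near (e s')) = A (e s) (+) A (e s').
    apply: H; apply: le_lt_trans ss'; apply: mdist_le_polygonal.
    by rewrite !eP//; exact: polygonal_edge.
  have : E (near (e s)) u (+) E u (near (e s')) = E (near (e s)) (near (e s')).
    apply: E3; case: (near_e s s01) => ->; case: (near_e s' s01') => ->;
      by [exact: Or31|exact: Or32|exact: Or33].
  rewrite H (Esym u).
  by move: (A (e s)) (A (e s')) (E (near (e s)) u) (E (near (e s')) u); do 4 case.
rewrite /B e0 e1 (vert_near u (pt u))// (vert_near v (pt v))// Eirr addbF /= => ->.
by rewrite (Esym v) -addbA addbC addbK.
Qed.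

(** Follow a polygonal path from [u] to [v]: [P] passes between the vertices supporting successive
    points of the path. *)
Lemma adj_ind (P : vertex K -> Prop) u : P u ->
  (forall v w, adj v w -> P v -> P w) -> forall v, P v.
Proof.
move=> Pu Padj v.
have key (p q : vertex K -> R) (l : R) : polygonal p q l -> forall a b, 0 < p a -> 0 < q b -> P a -> P b.
  have step a b w w' (s s' : R) : adj a b -> 0 < edge_pt a b s w ->
      0 < edge_pt a b s' w' -> P w -> P w'.
    move=> ab; have ba : adj b a by rewrite adj_sym.
    by move=> /edge_pt_gt0[]-> /edge_pt_gt0[]->//; exact: Padj.
  elim=> [{}p [a [b [s [ab s01 ->]]]] w w'|a b s t {}q {}l ab s01 t01 _ IH w w'].
    move: ab => /orP[/eqP <-|ab]; last exact: step ab.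
    by move=> /edge_pt_gt0[]-> /edge_pt_gt0[]->.
  move=> wp wq Pw; have [w1 w1P] : exists w1, 0 < edge_pt a b t w1.
    have nab : a != b by apply: contraTneq ab => ->; rewrite adj_irr.
    have [t0|t0] := leP t 0.
      by exists a; rewrite edge_ptl//; lra.
    by exists b; rewrite edge_ptr//; lra.
  apply: (IH w1 w') => //; exact: step ab wp w1P Pw.
have [x xu] := coord_surj (realization_vertex u).
have [y yv] := coord_surj (realization_vertex v).
have [l] := polygonal_exists x y; rewrite xu yv => /key kP.
by apply: (kP u v) => //; rewrite edge_pt_vertex.
Qed.

End tree_coordinates.

(** * Rooted trees *)

Section rooted_structure.
Context {R : realType} {T : metricType R} {K : complex1}.
Context (coord : T -> (vertex K -> R)).
Context (coord_bij : set_bij [set: T] (realization R K) coord).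
Context (coord_dist : forall x y, (mdist x y)%:E = path_dist (coord x) (coord y)).
Implicit Types (u v w : vertex K).

(** Breadth-first spanning tree: [dep v] is the length of a shortest walk from [o], and [par v] the
    last vertex but one of such a walk. The root is its own parent by convention. *)
Lemma exists_depth (o : vertex K) : exists (dep : vertex K -> nat) (par : vertex K -> vertex K),
  [/\ dep o = 0%N, par o = o &
      forall v, v != o -> adj v (par v) /\ dep v = (dep (par v)).+1].
Proof.
pose reach := fix reach n v := if n is m.+1 then exists2 w, reach m w & adj w v
                               else v = o.
have reachP v : exists n, reach n v.
  move: v; apply: (adj_ind coord_bij coord_dist (u := o)); first by exists 0%N.
  by move=> v w vw [n nv]; exists n.+1, v.
have depP v : exists n, reach n v /\ forall m, reach m v -> (n <= m)%N.
  have ex : exists n, `[< reach n v >] by have [n nv] := reachP v; exists n; apply/asboolP.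
  exists (ex_minn ex); case: ex_minnP => n /asboolP nv nmin; split=> // m mv.
  exact/nmin/asboolP.
have [dep {}depP] := choice depP.
have dep0 : dep o = 0%N by apply/eqP; rewrite -leqn0; exact: (depP o).2.
have parP v : exists w, (v = o -> w = o) /\
    (v != o -> adj v w /\ dep v = (dep w).+1).
  have [->|vo] := eqVneq v o; first by exists o.
  have [+ vmin] := depP v; case E : (dep v) => [|n] /=.
    by move=> vo'; rewrite vo' eqxx in vo.
  move=> [w nw wv]; exists w; split=> [vo'|_]; first by rewrite vo' eqxx in vo.
  split; first by rewrite adj_sym.
  congr S; apply/eqP; rewrite eqn_leq (depP w).2// andbT.
  have : reach (dep w).+1 v by exists w => //; exact: (depP w).1.
  by move=> /vmin; rewrite E.
have [par {}parP] := choice parP; exists dep, par; split=> // [|v]; first exact: (parP o).1.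
exact: (parP v).2.
Qed.

(* The edges outside a spanning tree form a cut; as it misses the spanning
   tree, it is empty. *)
Lemma contractible_rooted (o : vertex K) : contractible R T ->
  exists (dep : vertex K -> nat) (par : vertex K -> vertex K),
  [/\ dep o = 0%N, par o = o,
      forall v, v != o -> adj v (par v) /\ dep v = (dep (par v)).+1 &
      forall u v, adj u v -> (u != o /\ par u = v) \/ (v != o /\ par v = u)].
Proof.
move=> Tcontr; have [dep [par [dep0 par0 parP]]] := exists_depth o.
exists dep, par; split=> // u v uv.
pose E u v := [&& adj u v, par u != v & par v != u].
have [||A AP] := contractible_cut coord_bij coord_dist (E := E) Tcontr.
- by move=> a b; rewrite /E adj_sym; congr andb; rewrite andbC.
- by move=> a; rewrite /E adj_irr.
(* [E] vanishes on the edges from a vertex to its parent, so [A] is constant by descent to the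
   root. *)
have Ao a : A a = A o.
  have [n] := ubnP (dep a); elim: n a => // n IH a an.
  have [->//|ao] := eqVneq a o; have [aa da] := parP a ao.
  rewrite -(IH (par a)); last by rewrite da in an.
  by apply/eqP; rewrite -negb_add AP// /E eqxx /= !andbF.
have : E u v = false by rewrite -AP// !Ao addbb.
have neo a b : adj a b -> par a = b -> a != o.
  by move=> ab pa; apply: contraTneq ab => ao; rewrite -pa ao par0 adj_irr.
rewrite /E uv /=; case: eqVneq => [pu _|_ /=].
  by left; split=> //; exact: neo pu.
case: eqVneq => // pv _; right; split=> //.
by apply: neo pv; rewrite adj_sym.
Qed.

End rooted_structure.

(** * Ancestors and branching depths of vertices *)

Section ancestors.
Context {V : eqType} (o : V) (dep : V -> nat) (par : V -> V).
Context (dep0 : dep o = 0%N) (par0 : par o = o).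
Context (dep_par : forall v, v != o -> dep v = (dep (par v)).+1).
Implicit Types u v w : V.

Lemma dep_iter n v : dep (iter n par v) = (dep v - n)%N.
Proof.
elim: n => [|n IHn]; first by rewrite subn0.
rewrite /= subnS -IHn; have [->|no] := eqVneq (iter n par v) o.
  by rewrite par0 dep0.
by rewrite [in RHS]dep_par.
Qed.

Definition anc k v := iter (dep v - k) par v.

Lemma anc_dep v : anc (dep v) v = v. Proof. by rewrite /anc subnn. Qed.

Lemma anc_anc j k v : (j <= k <= dep v)%N -> anc j (anc k v) = anc j v.
Proof.
move=> /andP[jk kv]; rewrite /anc dep_iter subKn// -iterD addnC addnBA//.
by rewrite subnK.
Qed.

Lemma anc_par k v : (k < dep v)%N -> anc k (par v) = anc k v.
Proof.
move=> kv; have vo : v != o by apply: contraTneq kv => ->; rewrite dep0.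
have dv := dep_par vo.
have -> : par v = anc (dep (par v)) v by rewrite /anc dv subSnn.
by rewrite anc_anc// dv leqnSn andbT -ltnS -dv.
Qed.

Definition common k v w := [&& (k <= dep v)%N, (k <= dep w)%N & anc k v == anc k w].

(** Equal ancestors have equal ancestors, so the common depths form an initial segment. It contains
    0, thanks to the root, and is bounded by [dep v]; its maximum determines it. *)
Lemma exists_branch_depth : exists lca : V -> V -> nat,
  forall v w k, (k <= lca v w)%N = common k v w.
Proof.
have lcaP p : exists n, forall k, (k <= n)%N = common k p.1 p.2.
  case: p => v w /=.
  have anc0 a : anc 0 a = o.
    apply/eqP; apply: contraTT isT => ao.
    by have := dep_par ao; rewrite dep_iter subn0 subnn.
  have ex : exists k, common k v w by exists 0%N; rewrite /common !anc0 eqxx.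
  have bd k : common k v w -> (k <= dep v)%N by case/and3P.
  exists (ex_maxn ex bd); case: ex_maxnP => n /and3P[nv nw /eqP nvw] nmax k.
  apply/idP/idP => [kn|]; last exact: nmax.
  rewrite /common (leq_trans kn nv) (leq_trans kn nw)/=.
  by rewrite -(anc_anc (k := n) (v := v)) ?kn// nvw anc_anc ?kn.
have [lca lcaE] := choice lcaP.
by exists (fun v w => lca (v, w)) => v w k; rewrite lcaE.
Qed.

End ancestors.

(** The terms in [D] cancel, leaving a lower bound of [g x y + g z w] by the smaller of the two
    other sums of products; it follows from ultrametricity on four triples. *)
Lemma four_point_ultra {R : realType} (X : metricType R) (D : X -> R)
    (g : X -> X -> R) :
  (forall x y, mdist x y = D x + D y - 2 * g x y) ->
  (forall x y, g x y = g y x) ->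
  (forall x y z, g x y <= g x z \/ g y z <= g x z) ->
  four_point X.
Proof.
move=> dE gC gU x y z w; rewrite leNgt gt_max; apply/negP => /andP[].
rewrite !dE; have := gU x z y; have := gU x w y; have := gU z x w; have := gU z y w.
rewrite (gC z y) (gC z x) (gC w y).
by do 4 case=> ?; lra.
Qed.

(** * Recognising and concatenating geodesics *)

Section geodesic_construction.
Context {R : realType} {X : metricType R}.
Implicit Types x y z : X.

(** A 1-Lipschitz curve whose duration is the distance of its ends cannot shorten any piece without
    violating the triangle inequality. *)
Lemma short_geodesic x y (u : R -> X) : u 0 = x -> u (mdist x y) = y ->
  (forall s t, 0 <= s -> s <= t -> t <= mdist x y -> mdist (u s) (u t) <= t - s) ->
  geodesic x y u.
Proof.
move=> u0 u1 us; split=> // s t.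
wlog st : s t / s <= t => [H s01 t01|/andP[s0 _] /andP[t0 t1]].
  have [/H->//|/ltW ts] := leP s t; by rewrite metric_sym distrC H.
apply/eqP; rewrite eq_le ler0_norm ?subr_le0// opprB us//=.
have d0 := mdist_ge0 x y.
have := us 0 s (lexx _) s0 (le_trans st t1); have := us t _ t0 t1 (lexx _).
have := metric_triangle x (u s) y; have := metric_triangle (u s) (u t) y.
by rewrite u0 u1; lra.
Qed.

Lemma geodesic_cat x y z u v : geodesic x y u -> geodesic y z v ->
  mdist x z = mdist x y + mdist y z -> exists w, geodesic x z w.
Proof.
move=> xy yz xyz; have d1 := mdist_ge0 x y; have d2 := mdist_ge0 y z.
have [u0 u1 uP] := xy; have [v0 v1 vP] := yz.
exists (fun s => if s <= mdist x y then u s else v (s - mdist x y)).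
apply: short_geodesic; first by rewrite d1.
  rewrite xyz gerDl; case: ifPn => [d20|_]; last by rewrite addrC addKr.
  have yz0 : mdist y z = 0 by lra.
  by rewrite yz0 addr0 u1; exact: mdist_positivity.
move=> s t s0 st txz; case: ifPn => sx; case: ifPn => tx.
- by rewrite uP ?ler0_norm ?subr_le0 ?opprB//; lra.
- apply: le_trans (metric_triangle _ y _) _; rewrite -ltNge in tx.
  by rewrite (geodesic_distr xy) ?(geodesic_distl yz); lra.
- by rewrite -ltNge in sx; lra.
- by rewrite -!ltNge in sx tx; rewrite vP ?ler0_norm; lra.
Qed.

End geodesic_construction.

(** * The metric of a geometric tree *)

Section polygonal_geodesics.
Context {R : realType} {T : metricType R} {K : complex1}.
Context (coord : T -> (vertex K -> R)).
Context (coord_bij : set_bij [set: T] (realization R K) coord).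
Context (coord_dist : forall x y, (mdist x y)%:E = path_dist (coord x) (coord y)).

Lemma edge_geodesic x y u v s t : adj u v -> 0 <= s <= 1 -> 0 <= t <= 1 ->
  coord x = edge_pt u v s -> coord y = edge_pt u v t -> mdist x y = `|s - t| ->
  exists w, geodesic x y w.
Proof.
move=> uv s01 t01 xE yE dxy.
have edge r : exists z, 0 <= r <= 1 -> coord z = edge_pt u v r.
  have [r01|] := boolP (0 <= r <= 1); last by exists x.
  by have [z] := coord_surj coord_bij (realization_edge uv r01); exists z.
have [e eP] := choice edge.
have eE z r : 0 <= r <= 1 -> coord z = edge_pt u v r -> e r = z.
  move=> r01 zE; case: coord_bij => _ inj _; apply: inj; rewrite ?in_setT//.
  by rewrite eP.
(* Unit speed motion from [s] to [t]; the sign covers both directions. *)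
pose p r := s + Num.sg (t - s) * r.
have p01 r : 0 <= r <= `|s - t| -> 0 <= p r <= 1.
  by rewrite /p distrC; case: sgrP => [|ts|ts]; lra.
exists (e \o p); apply: short_geodesic => [||r r' r0 rr' rd] /=.
- by rewrite /p mulr0 addr0; exact: eE.
- by apply: eE => //; rewrite /p dxy distrC mulr_sg_norm addrC subrK.
- rewrite dxy in rd; apply: (mdist_le_polygonal coord_dist).
  have pr : 0 <= p r <= 1 by apply: p01; rewrite r0 (le_trans rr').
  have pr' : 0 <= p r' <= 1 by apply: p01; rewrite rd (le_trans r0).
  rewrite !eP//; have [ts|ts] := eqVneq t s.
    have -> : r' = r by rewrite ts subrr normr0 in rd; lra.
    have := polygonal_edge uv pr pr; by rewrite !subrr normr0.
  have := polygonal_edge uv pr pr'; rewrite /p opprD addrACA subrr add0r -mulrBr.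
  by rewrite normrM normr_sg subr_eq0 ts mul1r ler0_norm ?subr_le0// opprB.
Qed.

(** When the infimum of lengths is attained by a path, its first edge step and its remainder are
    shortest too, so geodesics of the pieces concatenate. *)
Lemma polygonal_geodesic x y :
  polygonal (coord x) (coord y) (mdist x y) -> exists u, geodesic x y u.
Proof.
have key p q (l : R) : polygonal p q l -> forall x y, coord x = p -> coord y = q ->
    mdist x y = l -> exists u, geodesic x y u.
  elim=> [{}p _ {}x {}y <- yx d0|u v s t {}q {}l uv s01 t01 zy IH {}x {}y xE yE dxy].
    exists (fun=> x); have xy : x = y by exact: mdist_positivity.
    apply: short_geodesic => // s t s0 st _.
    by rewrite mdistxx subr_ge0.
  have [z zE] := coord_surj coord_bij (realization_edge uv t01).
  have dxz : mdist x z <= `|s - t|.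
    by apply: (mdist_le_polygonal coord_dist); rewrite xE zE; exact: polygonal_edge.
  have dzy : mdist z y <= l.
    by apply: (mdist_le_polygonal coord_dist); rewrite zE yE.
  have tri := metric_triangle x z y; rewrite dxy in tri.
  have dxzE : mdist x z = `|s - t| by lra.
  have dzyE : mdist z y = l by lra.
  have [w1 xz] := edge_geodesic uv s01 t01 xE zE dxzE.
  have [w2 zy2] := IH z y zE yE dzyE.
  by apply: (geodesic_cat xz zy2); rewrite dxzE dzyE.
by move=> xy; exact: (key _ _ _ xy).
Qed.

End polygonal_geodesics.

Section tree_metric.
Context {R : realType} {T : metricType R} {K : complex1}.
Context (coord : T -> (vertex K -> R)).
Context (coord_bij : set_bij [set: T] (realization R K) coord).
Context (coord_dist : forall x y, (mdist x y)%:E = path_dist (coord x) (coord y)).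
Context (o : vertex K) (dep : vertex K -> nat) (par : vertex K -> vertex K).
Context (dep0 : dep o = 0%N) (par0 : par o = o).
Context (parP : forall v, v != o -> adj v (par v) /\ dep v = (dep (par v)).+1).
Context (adjP : forall u v, adj u v ->
  (u != o /\ par u = v) \/ (v != o /\ par v = u)).
Implicit Types (x y z : T) (u v w : vertex K) (s t : R).

Let dep_par v (vo : v != o) : dep v = (dep (par v)).+1 := (parP vo).2.

Let coord_inj x y : coord x = coord y -> x = y.
Proof. by case: coord_bij => _ + _ => inj xy; apply: inj; rewrite ?in_setT. Qed.

(* [par v] and [v] span the edge pointing to [o] at [v]; every point other than
   the root lies in exactly one such edge deprived of [par v]. *)
Definition below x v s := [/\ 0 < s <= 1, v = o -> s = 1 & coord x = edge_pt (par v) v s].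

Lemma exists_below x : exists vs : vertex K * R, below x vs.1 vs.2.
Proof.
have vert v : coord x = edge_pt v v 0 -> below x v 1.
  by move=> xv; split; rewrite ?ltr01 ?lexx// edge_pt1.
have edge v s : v != o -> 0 <= s <= 1 -> coord x = edge_pt (par v) v s ->
    exists vs : vertex K * R, below x vs.1 vs.2.
  move=> vo s01 xE; have [s0|s0] := leP s 0.
    have s00 : s = 0 by lra.
    by exists (par v, 1); apply: vert; rewrite xE s00 edge_pt0.
  by exists (v, s); split=> //=; [rewrite s0; case/andP: s01|move=> vo'; rewrite vo' eqxx in vo].
have [u [v [s [/orP[/eqP <-|uv] s01 xE]]]] := coord_realization coord_bij x.
  by exists (u, 1); apply: vert; rewrite xE edge_ptxx.
have [[uo uE]|[vo vE]] := adjP uv.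
  by apply: (edge u (1 - s)) => //; [lra|rewrite uE -edge_pt_sym].
by apply: (edge v s) => //; rewrite vE.
Qed.

Let par_neq v : v != o -> par v != v.
Proof. by move=> vo; apply/eqP => pv; have := dep_par vo; rewrite pv => /n_Sn. Qed.

Lemma below_coord x v s : below x v s -> coord x v = s.
Proof.
move=> [s01 vo ->]; have [v0|] := eqVneq v o.
  by rewrite (vo v0) v0 par0 edge_pt_vertex.
by move=> /par_neq pv; rewrite edge_ptr.
Qed.

(** If [v] and [w] differed, each would be the parent of the other, against the growth of depth. The
    parameter is then the coordinate at [v], also at the root, where it is normalised to 1. *)
Lemma below_uniq x v s w t : below x v s -> below x w t -> v = w /\ s = t.
Proof.
move=> xv xw; have xvs := below_coord xv; have xwt := below_coord xw.
suff vw : v = w by split=> //; rewrite -xvs -xwt vw.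
have [/andP[s0 _] _ xE] := xv; have [/andP[t0 _] _ xE'] := xw.
have : v = par w \/ v = w by apply: (@edge_pt_gt0 R K (par w) w t); rewrite -xE' xvs.
have : w = par v \/ w = v by apply: (@edge_pt_gt0 R K (par v) v s); rewrite -xE xwt.
move=> [wv|->//] [vw|//]; have [vo|vo] := eqVneq v o.
  by rewrite wv vo par0.
have := dep_par vo; rewrite -wv => dv.
have wo : w != o by apply: contraNneq vo => wo; rewrite vw wo par0.
have dwv : (dep w < dep v)%N by rewrite dv.
have dvw : (dep v < dep w)%N by rewrite (dep_par wo) -vw.
by have := ltn_trans dwv dvw; rewrite ltnn.
Qed.

(** An explicit candidate [rho] is shown to be at most the length of every polygonal path and to be
    the length of one of them; it is therefore the metric, and its formula gives the four-point
    inequality. *)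
Lemma rooted_real_tree : real_tree T.
Proof.
have [kv kvP] := choice exists_below.
pose k x := (kv x).1; pose c x := (kv x).2.
have kP x : below x (k x) (c x) by exact: kvP.
have [lca lcaE] := exists_branch_depth dep0 par0 dep_par.
(* Distance to the root, counted from the parent of [k x]; at the root itself the parameter 1
   cancels the -1. *)
pose D x : R := (dep (k x))%:R - 1 + c x.
(* Gromov product at the root: the branching depth, unless one of the points lies on the way from
   the other to the root. *)
pose g x y := Num.min (Num.min (D x) (D y)) (lca (k x) (k y))%:R.
pose rho x y := D x + D y - 2 * g x y.
have lcaC v w : lca v w = lca w v.
  apply/eqP; rewrite eqn_leq; apply/andP; split.
    by rewrite lcaE /common eq_sym andbCA -/(common _ _ _ _ _) -lcaE.
  by rewrite lcaE /common eq_sym andbCA -/(common _ _ _ _ _) -lcaE.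
have lcaU u v w : (lca u v <= lca u w)%N \/ (lca v w <= lca u w)%N.
  have cT n : common dep par n u v -> common dep par n v w -> common dep par n u w.
    by rewrite /common => /and3P[-> _ /eqP->] /and3P[_ -> ->].
  have [uv|/ltnW vw] := leqP (lca u v) (lca v w); [left|right];
    rewrite (lcaE u w); apply: cT; rewrite -lcaE ?leqnn//.
have lcavv v : lca v v = dep v.
  apply/eqP; rewrite eqn_leq lcaE /common leqnn eqxx !andbT.
  by have := leqnn (lca v v); rewrite {1}lcaE => /and3P[->].
have lca_par v : v != o -> (lca (par v) v).+1 = dep v.
  move=> vo; have dv := dep_par vo; rewrite dv; congr S; apply/eqP; rewrite eqn_leq.
  have := leqnn (lca (par v) v); rewrite {1}lcaE => /and3P[-> _ _] /=.
  by rewrite lcaE /common leqnn dv leqnSn /= (anc_par dep0 par0 dep_par (v := v)) ?dv.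
have gC x y : g x y = g y x by rewrite /g (minC (D x)) lcaC.
have rhoC x y : rho x y = rho y x by rewrite /rho gC; lra.
have gP x y : [/\ g x y <= D x, g x y <= D y & g x y <= (lca (k x) (k y))%:R].
  by rewrite /g; split; rewrite !ge_min lexx ?orbT.
have le_g x y (m : R) : m <= D x -> m <= D y -> m <= (lca (k x) (k y))%:R -> m <= g x y.
  by move=> mx my ml; rewrite /g !le_min mx my.
have gU x y z : g x y <= g x z \/ g y z <= g x z.
  have [xy1 xy2 xy3] := gP x y; have [yz1 yz2 yz3] := gP y z.
  have [] := lcaU (k x) (k y) (k z); rewrite -(ler_nat R) => H.
    have [xyz|xyz] := leP (g x y) (D z); [left|right]; apply: le_g => //; lra.
  have [yzx|yzx] := leP (g y z) (D x); [right|left]; apply: le_g => //; lra.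
have cP x : 0 < c x <= 1 by case: (kP x).
have rho_abs x y : Num.min (D x) (D y) <= (lca (k x) (k y))%:R -> rho x y = `|D x - D y|.
  move=> lcaxy; rewrite /rho /g (min_l lcaxy).
  by case: (leP (D x) (D y)) => xy; [rewrite ler0_norm|rewrite gtr0_norm]; lra.
have rhoxx x : rho x x = 0.
  rewrite rho_abs ?subrr ?normr0// minxx lcavv /D.
  by have := cP x; lra.
have rho_tri x y z : rho x z <= rho x y + rho y z.
  have [_ xy2 _] := gP x y; have [yz1 _ _] := gP y z.
  by rewrite /rho; have [] := gU x y z; lra.
have tree_edge (x : T) (w : vertex K) (s : R) : w != o -> 0 <= s <= 1 -> coord x = edge_pt (par w) w s ->
    D x = (dep w)%:R - 1 + s /\ (k x = w \/ k x = par w /\ s = 0).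
  (* At parameter 0 the point is the vertex [par w], which [below] attaches to its own edge with
     parameter 1. *)
  move=> vo /andP[s0 s1] xE; have [s00|sn0] := eqVneq s 0.
    have xb : below x (par w) 1.
      by split; rewrite ?ltr01 ?lexx// xE s00 edge_pt0 edge_pt1.
    have [kx cx] := below_uniq (kP x) xb.
    by rewrite /D kx cx s00 (dep_par vo) -natr1; split; [lra|right].
  have xb : below x w s.
    by split=> // [|vo']; [rewrite lt_neqAle eq_sym sn0 s0|rewrite vo' eqxx in vo].
  by have [kx cx] := below_uniq (kP x) xb; rewrite /D kx cx; split=> //; left.
have rho_edge v x y s t : v != o -> 0 <= s <= 1 -> 0 <= t <= 1 ->
    coord x = edge_pt (par v) v s -> coord y = edge_pt (par v) v t ->
    rho x y = `|s - t|.
  move=> vo s01 t01 xE yE.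
  have [Dx kx] := tree_edge x v s vo s01 xE; have [Dy ky] := tree_edge y v t vo t01 yE.
  have lp : (lca (par v) v)%:R = (dep v)%:R - 1 :> R.
    by rewrite -(lca_par v vo) -natr1 addrK.
  have lpp : (dep (par v))%:R = (dep v)%:R - 1 :> R by rewrite (dep_par vo) -natr1 addrK.
  rewrite rho_abs; first by rewrite Dx Dy; congr `|_|; lra.
  rewrite Dx Dy ge_min; apply/orP.
  case: kx ky => [->|[-> s0]] [->|[-> t0]]; rewrite ?(lcaC v (par v)) ?lcavv ?lp ?lpp.
  - by left; lra.
  - by right; lra.
  - by left; lra.
  - by left; lra.
(* Along each edge [rho] is the length of the step, and it satisfies the triangle inequality. *)
have rho_le p q (l : R) : polygonal p q l -> forall x y, coord x = p -> coord y = q ->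
    rho x y <= l.
  elim=> [{}p _ x y <- /coord_inj->|u v s t {}q {}l uv s01 t01 _ IH x y xE yE].
    by rewrite rhoxx.
  have [z zE] := coord_surj coord_bij (realization_edge uv t01).
  apply: le_trans (rho_tri x z y) _; apply: lerD; last exact: IH.
  have [[uo pu]|[vo pv]] := adjP uv; last first.
    by rewrite (rho_edge v x z s t)// pv.
  rewrite (rho_edge u x z (1 - s) (1 - t)) ?pu -?edge_pt_sym//; [|lra|lra].
  by rewrite distrC; have -> : 1 - t - (1 - s) = s - t by lra.
have up_vertex n v : (n <= dep v)%N ->
    polygonal (edge_pt v v 0) (edge_pt (iter n par v) (iter n par v) (0 : R)) n%:R.
  elim: n => [|n IHn] nv; first exact/polygonal_nil/realization_vertex.
  rewrite -natr1 iterS; apply: polygonal_cat (IHn (ltnW nv)) _.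
  set w := iter n par v.
  have wo : w != o.
    have : dep w != 0%N by rewrite (dep_iter dep0 par0 dep_par) subn_eq0 -ltnNge.
    by apply: contraNneq => ->; rewrite dep0.
  have [ww _] := parP wo; have := @polygonal_edge R K w (par w) 0 1 ww.
  rewrite edge_pt0 edge_pt1 sub0r normrN1; apply; by rewrite lexx ler01.
have up_self x : polygonal (coord x) (edge_pt (k x) (k x) 0) ((dep (k x))%:R - D x).
  have [c01 co xE] := kP x; have [kxo|kxo] := eqVneq (k x) o.
    rewrite xE (co kxo) edge_pt1 /D (co kxo) subrK subrr.
    exact/polygonal_nil/realization_vertex.
  have [kk _] := parP kxo; rewrite adj_sym in kk.
  have := @polygonal_edge R K _ _ (c x) 1 kk; rewrite -xE edge_pt1.
  have -> : `|c x - 1| = (dep (k x))%:R - D x by rewrite /D ler0_norm; lra.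
  by apply; lra.
have up x n : (n < dep (k x))%N ->
    polygonal (coord x) (edge_pt (anc dep par n (k x)) (anc dep par n (k x)) 0) (D x - n%:R).
  move=> nk; have [c01 _ xE] := kP x.
  have kxo : k x != o by apply: contraTneq nk => ->; rewrite dep0.
  have [kk dk] := parP kxo; rewrite adj_sym in kk.
  have := @polygonal_edge R K _ _ (c x) 0 kk; rewrite -xE edge_pt0 subr0 => h.
  have {}h : polygonal (coord x) (edge_pt (par (k x)) (par (k x)) 0) (c x).
    by rewrite ger0_norm in h; [apply: h; lra|lra].
  have -> : D x - n%:R = c x + (dep (par (k x)) - n)%:R.
    by rewrite natrB ?/D ?dk -?natr1; [lra|rewrite -ltnS -dk].
  apply: polygonal_cat h _; rewrite -(anc_par dep0 par0 dep_par)//.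
  exact/up_vertex/leq_subr.
have D_gt x : (dep (k x))%:R - 1 < D x <= (dep (k x))%:R.
  by rewrite /D; have := cP x; lra.
(* Here [k x] is a proper ancestor of [k y]: the path leaves [x] away from the root to [k x] and
   then descends to [y]. *)
have asc x y : lca (k x) (k y) = dep (k x) -> k x != k y ->
    polygonal (coord x) (coord y) (rho x y).
  move=> lk nk; have := leqnn (lca (k x) (k y)).
  rewrite {1}lcaE lk => /and3P[_ ky /eqP ak]; rewrite anc_dep in ak.
  have ky' : (dep (k x) < dep (k y))%N.
    rewrite ltn_neqAle ky andbT; apply: contraNneq nk => dxy.
    by rewrite {1}ak dxy anc_dep.
  have kyR : (dep (k x))%:R + 1 <= (dep (k y))%:R :> R by rewrite natr1 ler_nat.
  have := D_gt x; have := D_gt y => Dy Dx.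
  have -> : rho x y = ((dep (k x))%:R - D x) + (D y - (dep (k x))%:R).
    rewrite rho_abs; first by rewrite ler0_norm; lra.
    by rewrite lk ge_min; apply/orP; left; lra.
  apply: polygonal_cat (up_self x) _; apply: polygonal_sym.
  by have := up y _ ky'; rewrite -ak.
(* Three situations: both points on one edge, one of [k x] and [k y] a proper ancestor of the other,
   or two ascents meeting at the branching vertex. *)
have rho_poly x y : polygonal (coord x) (coord y) (rho x y).
  have [kxy|nk] := eqVneq (k x) (k y).
    have [_ cox xE] := kP x; have [_ coy yE] := kP y.
    have [kxo|kxo] := eqVneq (k x) o.
      have -> : x = y.
        by apply: coord_inj; rewrite xE yE (cox kxo) coy -?kxy.
      by rewrite rhoxx; exact/polygonal_nil/coord_realization.
    have [kk _] := parP kxo; rewrite adj_sym in kk.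
    rewrite -kxy in yE; have [cx cy] := (cP x, cP y).
    rewrite (rho_edge (k x) x y (c x) (c y))//; [|lra|lra].
    by rewrite xE yE; apply: polygonal_edge => //; lra.
  have := leqnn (lca (k x) (k y)); rewrite {1}lcaE => /and3P[lx ly /eqP axy].
  move: lx; rewrite leq_eqVlt => /orP[/eqP lx|lx]; first exact: asc.
  move: ly; rewrite leq_eqVlt => /orP[/eqP ly|ly].
    rewrite rhoC; apply: polygonal_sym; apply: asc; last by rewrite eq_sym.
    by rewrite lcaC.
  have [Dx Dy] := (D_gt x, D_gt y).
  have lxR : (lca (k x) (k y))%:R + 1 <= (dep (k x))%:R :> R by rewrite natr1 ler_nat.
  have lyR : (lca (k x) (k y))%:R + 1 <= (dep (k y))%:R :> R by rewrite natr1 ler_nat.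
  have -> : rho x y = (D x - (lca (k x) (k y))%:R) + (D y - (lca (k x) (k y))%:R).
    by rewrite /rho /g min_r; [lra|rewrite le_min; lra].
  apply: polygonal_cat (up x _ lx) _; rewrite axy; apply: polygonal_sym.
  exact: up.
have distE x y : mdist x y = rho x y.
  apply/eqP; rewrite eq_le (mdist_le_polygonal coord_dist (rho_poly x y)) /=.
  by apply: (mdist_ge_polygonal coord_dist) => l /rho_le; apply.
split=> [x y|]; last exact: (four_point_ultra (D := D) (g := g)).
apply: (polygonal_geodesic coord_bij coord_dist); rewrite distE; exact: rho_poly.
Qed.

End tree_metric.

Lemma lfGTree_real_tree (R : realType) (X : lfGTree R) : real_tree X.
Proof.
have [K [coord [_ coord_bij coord_dist Xcontr]]] := lfGTreeP X.
(* The centre of the contraction provides a point, and an end of its edge serves as root. *)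
have [x _] := Xcontr; have [u _] := coord_realization coord_bij x.
have [dep [par [dep0 par0 parP adjP]]] := contractible_rooted coord_bij coord_dist u Xcontr.
exact (rooted_real_tree coord_bij coord_dist dep0 par0 parP adjP).
Qed.

Theorem theorem9p9 (R : realType) :
  [/\ is_functor (EndsF R),
      (forall (X Y : lfGTree R) (f : coarse_map X Y) (r : halfline R -> X)
         (u : Y -> Y -> R -> Y), geodesic_ray r -> geodesic_choice u ->
         proper_ray (star u (f \o r)) /\
         fun_map (EndsF R) f (end_of r) = end_of (star u (f \o r))),
      is_functor (pi0CrsF R),
      (forall (X Y : lfGTree R) (f : coarse_map X Y) (a : halfline R -> X),
         coarse a ->
         fun_map (pi0CrsF R) f (crs_class a) = crs_class (f \o a)) &
      naturally_isomorphic (EndsF R) (pi0CrsF R)].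
Proof.
have treeP := @lfGTree_real_tree R.
split.
- exact: EndsF_functor.
- by move=> X Y f r u; exact: EndsF_map.
- exact: pi0CrsF_functor.
- by move=> X Y f a; exact: pi0CrsF_map.
- exact: EndsF_pi0CrsF_isomorphic.
Qed.
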